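(* Let $X$ be a Banach space with scalar field $\mathbb F$ and let $\gamma\in BC(\mathbb R,\mathbb F)$ satisfy (i) $\inf_{t\in\mathbb R}|\gamma(t)|>0$; (ii) $\gamma\,BUC(\mathbb R,X)$ is invariant; (iii) $\gamma\,BUC(\mathbb R,X)\subset M(\gamma\,BUC(\mathbb R,X))$; (iv) $\limsup_{|t|\to\infty}\|u(t)\|\le\|u+\gamma v\|_\infty$ for all $u,v\in BUC(\mathbb R,X)$. Then for every interval $J$ of the form $[\alpha,\infty)$, $(\alpha,\infty)$ ($\alpha\in\mathbb R$) or $\mathbb R$, the vector sum $BUC(J,X)+(\gamma|_J)\,BUC(J,X)$ satisfies $(\Delta)$.
   Context: $X\neq\{0\}$ is a Banach space over $\mathbb F\in\{\mathbb R,\mathbb C\}$. $BC$ and $BUC$ denote bounded continuous and bounded uniformly continuous functions. $\|f\|_\infty=\sup_t\|f(t)\|$; on $\mathbb R$, $\limsup_{|t|\to\infty}$ is the maximum of the limsups as $t\to\infty$ and $t\to-\infty$. $L^1_{\rm loc}(J,X)$ is the set of all functions $f:J\to X$ (not equivalence classes) Bochner–Lebesgue integrable over every compact interval contained in $J$. For $U,V\subset X^J$, $\gamma V=\{\gamma v:v\in V\}$ and $U+V=\{u+v:u\in U,v\in V\}$. $A\subset X^{\mathbb R}$ is invariant if $f_a\in A$ for all $f\in A$, $a\in\mathbb R$, where $f_a(t)=f(t+a)$. For $h>0$: $(\Delta_hf)(t)=f(t+h)-f(t)$, $(M_hf)(t)=\frac1h\int_0^hf(t+s)\,ds$, and $MA=\{f\in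 L^1_{\rm loc}(J,X):M_hf\in A\text{ for all }h>0\}$. A set $A\subset X^J$ satisfies $(\Delta)$ if: whenever $f\in L^1_{\rm loc}(J,X)$ and $\Delta_af\in A$ for all $a>0$, then $f-M_hf\in A$ for all $h>0$. *)

(* Defs.v *)
From HB Require Import structures.
From mathcomp Require Import all_boot all_order all_algebra.
From mathcomp Require Import complex.
From mathcomp Require Import all_classical all_reals all_analysis.

Set Implicit Arguments.
Unset Strict Implicit.
Unset Printing Implicit Defensive.

Import Order.TTheory GRing.Theory Num.Theory.
Import numFieldNormedType.Exports.
Local Open Scope classical_set_scope.
Local Open Scope ring_scope.

Variant scalar_kind := RealScalars | ComplexScalars.

Definition scalars (R : realType) (k : scalar_kind) : numFieldType :=
  match k with RealScalars => R | ComplexScalars => R[i] end.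

Definition scalar_of_real (R : realType) (k : scalar_kind) : R -> scalars R k :=
  match k with
  | RealScalars => fun x => x
  | ComplexScalars => fun x => x%:C%C
  end.

Definition real_of_scalar (R : realType) (k : scalar_kind) : scalars R k -> R :=
  match k with
  | RealScalars => fun z => z
  | ComplexScalars => fun z => complex.Re z
  end.

(* The norm of a normedModType K takes its values in K, hence in R[i] for
   complex spaces (where it is a nonnegative real); this is the same norm with
   values in R. *)
Definition rnorm (R : realType) (k : scalar_kind)
    (V : normedModType (scalars R k)) (x : V) : R :=
  real_of_scalar `|x|.

(* A function J -> V is represented by a total function R -> V whose values
   outside J are irrelevant.  All notions below that take the domain J as a
   parameter depend only on the restriction of the functions to J (for (Delta),
   because J + h is contained in J for h > 0). *)
Section Spaces.
Context (R : realType) (k : scalar_kind).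
Local Notation K := (scalars R k).

Definition BC (V : normedModType K) (J : set R) : set (R -> V) :=
  [set f | {within J, continuous f} /\ [bounded f t | t in J]].

Definition BUC (V : normedModType K) (J : set R) : set (R -> V) :=
  [set f | unif_continuous (f : subspace J -> V) /\ [bounded f t | t in J]].

Definition sup_norm (V : normedModType K) (f : R -> V) : \bar R :=
  ereal_sup (range (fun t => (rnorm (f t))%:E)).

Definition limsup_norm (V : normedModType K) (f : R -> V) : \bar R :=
  maxe (limf_esup (fun t => (rnorm (f t))%:E) (pinfty_nbhs R))
       (limf_esup (fun t => (rnorm (f t))%:E) (ninfty_nbhs R)).

Definition scale_set (V : normedModType K) (g : R -> K) (A : set (R -> V)) :
    set (R -> V) :=
  [set (fun t => g t *: v t) | v in A].

Definition sum_set (V : normedModType K) (A B : set (R -> V)) : set (R -> V) :=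
  [set (fun t => u t + v t) | u in A & v in B].

Definition translate (V : normedModType K) (f : R -> V) (a : R) : R -> V :=
  fun t => f (t + a).

Definition invariant_set (V : normedModType K) (A : set (R -> V)) : Prop :=
  forall f, A f -> forall a : R, A (translate f a).

End Spaces.

Arguments BC {R k} V J.
Arguments BUC {R k} V J.

Section Bochner.
Context (R : realType) (k : scalar_kind) (V : normedModType (scalars R k)).

Definition simple_function (s : R -> V) : Prop :=
  finite_set (range s) /\
  forall x : V, measurable (s @^-1` [set x] : set (measurableTypeR R)).

Definition simple_integral (a b : R) (s : R -> V) : V :=
  \sum_(x \in range s)
    scalar_of_real k
      (fine (lebesgue_measure (`[a, b] `&` s @^-1` [set x]))) *: x.

(* The simple functions are Borel and the convergence is almost everywhere, so
   that f is only Lebesgue measurable in general.  The second integrand is then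
   Lebesgue measurable as well, and for a nonnegative Lebesgue measurable
   function the integral of the library (a supremum over the Borel simple
   functions below it) is the usual Lebesgue integral. *)
Definition bochner_approximation (a b : R) (f : R -> V) (s : nat -> R -> V) :
    Prop :=
  [/\ forall n, simple_function (s n),
      {ae lebesgue_measure, forall t : R, `[a, b]%classic t ->
         s n t @[n --> \oo] --> f t} &
      (\int[lebesgue_measure]_(t in `[a, b]) (rnorm (f t - s n t))%:E)%E
         @[n --> \oo] --> 0%E].

Definition bochner_integrable (a b : R) (f : R -> V) : Prop :=
  exists s, bochner_approximation a b f s.

Definition is_bochner_integral (a b : R) (f : R -> V) (x : V) : Prop :=
  exists2 s, bochner_approximation a b f s &
    simple_integral a b (s n) @[n --> \oo] --> x.

Definition bochner_integral (a b : R) (f : R -> V) : V :=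
  xget 0 [set x | is_bochner_integral a b f x].

Definition L1loc (J : set R) : set (R -> V) :=
  [set f | forall a b : R, a <= b -> `[a, b]%classic `<=` J ->
     bochner_integrable a b f].

Definition difference (h : R) (f : R -> V) : R -> V :=
  fun t => f (t + h) - f t.

Definition mean (h : R) (f : R -> V) : R -> V :=
  fun t => scalar_of_real k h^-1 *: bochner_integral 0 h (fun s => f (t + s)).

Definition mean_class (J : set R) (A : set (R -> V)) : set (R -> V) :=
  [set f | L1loc J f /\ forall h : R, 0 < h -> A (mean h f)].

Definition condition_Delta (J : set R) (A : set (R -> V)) : Prop :=
  forall f : R -> V, L1loc J f ->
    (forall a : R, 0 < a -> A (difference a f)) ->
    forall h : R, 0 < h -> A (fun t => f t - mean h f t).

End Bochner.

(* Main.v *)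
Require Import Defs.
From mathcomp Require Import all_boot all_order all_algebra.
From mathcomp Require Import all_classical all_reals all_analysis.
From mathcomp Require Import complex measurable_realfun ring lra.
Import Order.TTheory GRing.Theory Num.Theory.
Import numFieldNormedType.Exports.
Local Open Scope classical_set_scope.
Local Open Scope ring_scope.
Set Implicit Arguments.
Unset Strict Implicit.

(** Let [D_s f] be the difference [t |-> f (t + s) - f t] and [M_h] the mean over
    a window of length [h], so that [f - M_h f] is the negative of the average
    of [D_s f] over [s] in [0, h].  Each [D_s f] is a sum [u_s + gamma v_s] of
    the required form.  The summands are chosen for each [s] separately, without
    any measurability in [s], so that they cannot simply be averaged.  The proof
    only ever averages quantities computed from [f] and uses [u_s] and [v_s] to
    bound them for one fixed [s] at a time.

    The norms of the [D_s f] with [s] in [0, h] have a common bound [C]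
    ([uniform_difference_bound]): otherwise some differences with increments
    [b_n] at points [t_n] would be unbounded, whereas by Steinhaus's argument
    most [s] give moderate differences both from [t_n] to [t_n + s] and from
    [t_n + b_n] to the same point.  In particular [f] is bounded on the
    compact intervals of [J], and only Bochner integrals of bounded functions
    occur.

    For [delta > 0] put [g = M_delta f] and [p = f - g].  The function
    [g - M_h g] is the negative of the average of the functions
    [M_delta (D_s f)], which have the common Lipschitz constant [2 C / delta],
    hence it is bounded and uniformly continuous ([sub_mean_mean_buc]).  The
    function [p - M_h p] is the negative of the average of
    [D_s f - M_delta (D_s f)].  By the hypothesis on means,
    [M_delta (gamma v_s)] equals [gamma v'] with [v'] uniformly continuous, so that
<<
      (D_s f - M_delta (D_s f)) / gamma
        = (u_s - M_delta u_s) / gamma + (v_s - v'),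
>>
    where the first term is small once [delta] is small for this [s], and the
    second one has small oscillations at a small scale depending on [s] and
    [delta].  Fatou's lemma, used once for each of the two limits, turns this
    into a statement about the average ([iterated_bounded_integral_small]): the
    function [(p - M_h p) / gamma] has small oscillations at small scales
    ([normalized_remainder_small_oscillation]).  It is therefore uniformly close
    to its own mean over a short window, which is uniformly continuous.  Hence
    [f - M_h f] is a uniform limit of elements of the vector sum
    ([sub_mean_approximable]).

    The vector sum is closed under uniform limits ([uniform_limit_buc_on_sum]).
    Indeed [u] is bounded at infinity by the norm of [u + gamma v], and the part
    of [u] over a compact interval can be divided by [gamma] and moved to [v], so
    a small element of the sum is a sum of small elements
    ([controlled_decomposition]); a geometric series then concludes.

    The hypotheses on [gamma] concern functions on the whole line.  For a half-line
    [J] they are reached by composing [v] with a contraction of the line into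
    [J], and by multiplying with a cutoff that vanishes off [J]. *)

(** * Real-valued norms over either scalar field *)

Section RealNorm.
Context (R : realType) (k : scalar_kind).
Local Notation K := (scalars R k).
Local Notation sr := (@scalar_of_real R k).
Local Notation rs := (@real_of_scalar R k).

Lemma scalar_of_realD (x y : R) : sr (x + y) = sr x + sr y.
Proof. by case: k => //=; rewrite rmorphD. Qed.

Lemma scalar_of_realB (x y : R) : sr (x - y) = sr x - sr y.
Proof. by case: k => //=; rewrite rmorphB. Qed.

Lemma scalar_of_realM (x y : R) : sr (x * y) = sr x * sr y.
Proof. by case: k => //=; rewrite rmorphM. Qed.

Lemma scalar_of_real0 : sr 0 = 0.
Proof. by case: k. Qed.

Lemma scalar_of_real1 : sr 1 = 1.
Proof. by case: k. Qed.

Lemma ler_scalar_of_real (x y : R) : (sr x <= sr y) = (x <= y).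
Proof. by case: k => //=; rewrite lecR. Qed.

Lemma ltr_scalar_of_real (x y : R) : (sr x < sr y) = (x < y).
Proof. by case: k => //=; rewrite ltcR. Qed.

Lemma real_of_scalarK (x : K) : 0 <= x -> sr (rs x) = x.
Proof. by rewrite /K; case: k x => //= x x0; rewrite RRe_real// ger0_real. Qed.

Lemma scalar_of_realK (x : R) : rs (sr x) = x.
Proof. by case: k. Qed.

Lemma norm_scalar_of_real (a : R) : `|sr a| = sr `|a|.
Proof.
have [a0|a0] := leP 0 a.
  by rewrite !ger0_norm// -scalar_of_real0 ler_scalar_of_real.
rewrite !ltr0_norm//; last by rewrite -scalar_of_real0 ltr_scalar_of_real.
by rewrite -(add0r (- a)) scalar_of_realB scalar_of_real0 sub0r.
Qed.

Context (V : normedModType K).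
Implicit Types x y : V.

Lemma rnormE x : `|x| = sr (rnorm x).
Proof. by rewrite /rnorm real_of_scalarK. Qed.

Lemma rnorm_ge0 x : 0 <= rnorm x.
Proof. by rewrite -ler_scalar_of_real -rnormE scalar_of_real0. Qed.

Lemma rnorm0 : rnorm (0 : V) = 0.
Proof. by rewrite /rnorm normr0 -scalar_of_real0 scalar_of_realK. Qed.

Lemma rnorm_eq0 x : rnorm x = 0 -> x = 0.
Proof. by move=> x0; apply/eqP; rewrite -normr_eq0 rnormE x0 scalar_of_real0. Qed.

Lemma rnormN x : rnorm (- x) = rnorm x.
Proof. by rewrite /rnorm normrN. Qed.

Lemma rnorm_distC x y : rnorm (x - y) = rnorm (y - x).
Proof. by rewrite -rnormN opprB. Qed.

Lemma rnormD x y : rnorm (x + y) <= rnorm x + rnorm y.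
Proof.
by rewrite -ler_scalar_of_real scalar_of_realD -!rnormE ler_normD.
Qed.

Lemma rnormB x y : rnorm (x - y) <= rnorm x + rnorm y.
Proof. by rewrite (le_trans (rnormD _ _))// rnormN. Qed.

Lemma rnorm_dist_sub x y : `|rnorm x - rnorm y| <= rnorm (x - y).
Proof.
rewrite ler_norml; apply/andP; split.
  by have := rnormD x (y - x); rewrite subrKC (rnorm_distC y x); lra.
by have := rnormD y (x - y); rewrite subrKC; lra.
Qed.

Lemma rnormZ (c : K) x : rnorm (c *: x) = rnorm (c : K^o) * rnorm x.
Proof.
rewrite -[LHS](@scalar_of_realK) -rnormE normrZ.
have -> : `|c| = sr (rnorm (c : K^o)) by rewrite /rnorm real_of_scalarK.
by rewrite rnormE -scalar_of_realM scalar_of_realK.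
Qed.

Lemma rnormZr (a : R) x : rnorm (sr a *: x) = `|a| * rnorm x.
Proof.
by rewrite rnormZ; congr (_ * _); rewrite /rnorm norm_scalar_of_real scalar_of_realK.
Qed.

Lemma rnorm_cvgP (T : Type) (F : set_system T) (FF : Filter F) (f : T -> V) x :
  f t @[t --> F] --> x <->
  (forall e : R, 0 < e -> \forall t \near F, rnorm (f t - x) <= e).
Proof.
split=> [/cvgrPdist_le fx e e0|fx].
  have := fx (sr e); rewrite -scalar_of_real0 ltr_scalar_of_real => /(_ e0).
  apply: filterS => t.
  by rewrite rnormE ler_scalar_of_real rnorm_distC.
apply/cvgrPdist_le => e e0.
have := fx (rs e).
rewrite -ltr_scalar_of_real real_of_scalarK ?scalar_of_real0; last exact: ltW.
move=> /(_ e0); apply: filterS => t.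
by rewrite -ler_scalar_of_real real_of_scalarK ?(ltW e0)// -rnormE distrC.
Qed.

Lemma rnorm_cvg (T : Type) (F : set_system T) (FF : Filter F) (f : T -> V) x :
  f t @[t --> F] --> x -> rnorm (f t) @[t --> F] --> rnorm x.
Proof.
move=> /rnorm_cvgP fx; apply/cvgrPdist_le => e e0.
apply: filterS (fx _ e0) => t; apply: le_trans.
by rewrite distrC rnorm_dist_sub.
Qed.

Lemma rnorm_boundedP (f : R -> V) (J : set R) :
  [bounded f t | t in J] <-> exists M : R, forall t, J t -> rnorm (f t) <= M.
Proof.
split=> [[M [Mreal fM]]|[M fM]].
  have lt0 : M < sr (rnorm (0 : V)) + `|M| + 1.
    rewrite rnorm0 scalar_of_real0 add0r.
    by rewrite (le_lt_trans (real_ler_norm Mreal))// ltrDl.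
  exists (rs (sr (rnorm (0 : V)) + `|M| + 1)) => t Jt.
  rewrite -ler_scalar_of_real real_of_scalarK.
    by rewrite -rnormE; exact: fM lt0 _ Jt.
  by rewrite rnorm0 scalar_of_real0 add0r addr_ge0.
exists (sr M); split.
  have [M0|M0] := leP 0 M.
    by rewrite ger0_real// -scalar_of_real0 ler_scalar_of_real.
  by rewrite ltr0_real// -scalar_of_real0 ltr_scalar_of_real.
move=> N MN t Jt /=; rewrite (le_trans _ (ltW MN))// rnormE.
by rewrite ler_scalar_of_real fM.
Qed.

Lemma rnorm_limit_unique (u : nat -> V) x y :
  u n @[n --> \oo] --> x -> u n @[n --> \oo] --> y -> x = y.
Proof. by move=> ux uy; apply: (cvg_unique _ ux uy); exact: norm_hausdorff. Qed.

Lemma entourage_rnormP (E : set (V * V)) :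
  entourage E <->
  exists2 e : R, 0 < e & forall x y, rnorm (x - y) < e -> E (x, y).
Proof.
split.
  rewrite -entourage_ballE => -[e /= e0 eE]; exists (rs e).
    rewrite -ltr_scalar_of_real real_of_scalarK ?scalar_of_real0//.
    exact: ltW.
  move=> x y xy; apply: eE => /=; rewrite -ball_normE/= rnormE.
  by rewrite -(real_of_scalarK (ltW e0)) ltr_scalar_of_real.
move=> [e e0 eE]; rewrite -entourage_ballE; exists (sr e) => /=.
  by rewrite -scalar_of_real0 ltr_scalar_of_real.
move=> [x y] /=; rewrite -ball_normE/= rnormE ltr_scalar_of_real.
exact: eE.
Qed.

End RealNorm.

Lemma rnorm_cauchy_cvg (R : realType) (k : scalar_kind)
    (V : completeNormedModType (scalars R k)) (u : nat -> V) :
  (forall e : R, 0 < e -> exists N, forall m n, (N <= m)%N -> (N <= n)%N ->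
     rnorm (u m - u n) <= e) ->
  exists x : V, u n @[n --> \oo] --> x.
Proof.
move=> uC; suff : cvg (u n @[n --> \oo]) by move=> ?; exists (lim (u n @[n --> \oo])).
apply/cauchy_cvgP; apply: cauchy_exP => e e0.
have [N NC] : exists N, forall m n, (N <= m)%N -> (N <= n)%N ->
     rnorm (u m - u n) <= real_of_scalar e / 2.
  apply: uC; rewrite divr_gt0// -(ltr_scalar_of_real k) real_of_scalarK ?scalar_of_real0//.
  exact: ltW.
exists (u N); exists N => // n /= Nn; rewrite -ball_normE/= rnormE.
rewrite -(real_of_scalarK (ltW e0)) ltr_scalar_of_real.
rewrite (le_lt_trans (NC _ _ _ _))// ltr_pdivrMr// ltr_pMr ?ltr1n//.
by rewrite -(ltr_scalar_of_real k) real_of_scalarK ?scalar_of_real0// ltW.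
Qed.

(** * Maps with finitely many values and Borel fibres *)

Section FiniteMeasurable.
Context (R : realType).
Local Notation mu := (@lebesgue_measure R).
Local Notation borel A := (measurable (A : set (measurableTypeR R))).

(** The codomain carries no structure, so that several simple functions are
    handled at once through the map into the product of their codomains. *)
Definition finite_measurable (T : Type) (s : R -> T) : Prop :=
  finite_set (range s) /\ forall x, borel (s @^-1` [set x]).

Lemma finite_measurable_preimage (T : Type) (s : R -> T) (B : set T) :
  finite_measurable s -> borel (s @^-1` B).
Proof.
move=> [sfin sm].
have -> : s @^-1` B = \bigcup_(x in range s `&` B) s @^-1` [set x].
  apply/seteqP; split=> [t Bst|t [x [_ Bx] /= ->]//].
  by exists (s t) => //; split => //; exists t.
by apply: fin_bigcup_measurable => //; exact: finite_setIl.
Qed.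

Lemma finite_measurable_comp (T U : Type) (s : R -> T) (g : T -> U) :
  finite_measurable s -> finite_measurable (fun t => g (s t)).
Proof.
move=> sm; split; last by move=> x; exact: (finite_measurable_preimage (g @^-1` [set x]) sm).
rewrite -(image_comp s g); apply: finite_image; exact: sm.1.
Qed.

Lemma finite_measurable_pair (T U : Type) (s : R -> T) (s' : R -> U) :
  finite_measurable s -> finite_measurable s' ->
  finite_measurable (fun t => (s t, s' t)).
Proof.
move=> sm s'm; split.
  apply: (@sub_finite_set _ _ (range s `*` range s')); last first.
    exact: finite_setX sm.1 s'm.1.
  by move=> _ [t _ <-]; split; exists t.
move=> [x y].
rewrite (_ : _ @^-1` _ = s @^-1` [set x] `&` s' @^-1` [set y]).
  by apply: measurableI; [exact: sm.2|exact: s'm.2].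
by apply/seteqP; split=> t /= [-> ->].
Qed.

Lemma finite_measurable_cst (T : Type) (x : T) :
  finite_measurable (fun _ : R => x).
Proof.
split; last first.
  move=> y; rewrite preimage_cst; case: ifPn => _; first exact: measurableT.
  exact: measurable0.
by apply: (@sub_finite_set _ _ [set x]) => // _ [t _ <-].
Qed.

Lemma finite_measurable_mem (A : set R) :
  borel A -> finite_measurable (fun t => t \in A).
Proof.
move=> mA; split; first exact: finite_finset.
case.
  rewrite (_ : _ @^-1` _ = A)//.
  by apply/seteqP; split=> t /=; [move/set_mem|move/mem_set].
rewrite (_ : _ @^-1` _ = ~` A); first exact: measurableC.
apply/seteqP; split=> t /=; last by move=> tA; exact: memNset.
by move=> /negbT/negP tA /mem_set.
Qed.

Lemma finite_measurable_measurable_fun (s : R -> R) (D : set R) :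
  finite_measurable s ->
  measurable_fun (D : set (measurableTypeR R)) (s : measurableTypeR R -> R).
Proof.
move=> sm mD B mB; apply: measurableI => //.
exact: finite_measurable_preimage.
Qed.

Lemma measurable_addr (r : R) :
  measurable_fun [set: measurableTypeR R] (fun t : measurableTypeR R => r + t : measurableTypeR R).
Proof. by apply: continuous_measurable_fun => t; apply: cvgD; [exact: cvg_cst|exact: cvg_id]. Qed.

Lemma borel_addr (r : R) (A : set R) : borel A -> borel [set t | A (r + t)].
Proof.
by move=> mA; have := measurable_addr r measurableT mA; rewrite setTI.
Qed.

Lemma finite_measurable_addr (T : Type) (s : R -> T) (r : R) :
  finite_measurable s -> finite_measurable (fun t => s (r + t)).
Proof.
move=> sm; split; last by move=> x; exact: borel_addr (sm.2 x).
by apply: (sub_finite_set _ sm.1) => _ [t _ <-]; exists (r + t).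
Qed.

(** Both sides are measures that agree on half-open intervals. *)
Lemma lebesgue_measure_addr (r : R) (A : set R) : borel A ->
  mu [set t | A (r + t)] = mu A.
Proof.
move=> mA.
have mr : measurable_fun [set: measurableTypeR R] (fun t : measurableTypeR R => r + t : measurableTypeR R).
  exact: measurable_addr.
rewrite (@lebesgue_measure_unique R (pushforward mu (fun t : measurableTypeR R => r + t : measurableTypeR R)) _ A)//.
move=> _ [[x y] _ <-] /=; rewrite /pushforward.
rewrite (_ : _ @^-1` _ = `]x - r, y - r]%classic).
  rewrite lebesgue_measure_itv/= lebesgue_measure_itv/= !lte_fin ltrBlDr subrK.
  by case: ifPn => // _; rewrite -!EFinB; congr (_%:E); ring.
by apply/seteqP; split=> t /=; rewrite !in_itv/= => /andP[]; lra.
Qed.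

End FiniteMeasurable.
Arguments finite_measurable {R T}.

(** * Integrals of simple functions *)

Section SimpleIntegral.
Context (R : realType) (k : scalar_kind) (V : normedModType (scalars R k)).
Local Notation mu := (@lebesgue_measure R).
Local Notation borel A := (measurable (A : set (measurableTypeR R))).
Local Notation sr := (@scalar_of_real R k).
Context (a b : R).
Local Notation D := (`[a, b]%classic : set R).

Lemma borel_itvcc : borel D.
Proof. exact: measurable_itv. Qed.
Hint Resolve borel_itvcc : core.

Lemma measure_itvccI_fin (A : set R) : borel A -> mu (D `&` A) \is a fin_num.
Proof.
move=> mA; rewrite ge0_fin_numE ?measure_ge0//.
apply: (@le_lt_trans _ _ (mu D)).
  by apply: le_measure; rewrite ?inE//; exact: measurableI.
by rewrite lebesgue_measure_itv; case: ifPn => //= _; rewrite -EFinB ltry.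
Qed.

Definition fibre_length (T : Type) (s : R -> T) (z : T) : R :=
  fine (mu (D `&` s @^-1` [set z])).

Lemma fibre_length_ge0 (T : Type) (s : R -> T) (z : T) : 0 <= fibre_length s z.
Proof. by rewrite fine_ge0// measure_ge0. Qed.

Lemma fibre_lengthE (T : Type) (s : R -> T) (z : T) : finite_measurable s ->
  mu (D `&` s @^-1` [set z]) = (fibre_length s z)%:E.
Proof. by move=> sm; rewrite fineK// measure_itvccI_fin//; exact: sm.2. Qed.

Lemma fibre_length_comp (T U : choiceType) (s : R -> T) (g : T -> U) (x : U) :
  finite_measurable s ->
  fibre_length (fun t => g (s t)) x =
    \sum_(z \in range s `&` g @^-1` [set x]) fibre_length s z.
Proof.
move=> sm; apply: EFin_inj; rewrite -fibre_lengthE; last exact: finite_measurable_comp.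
have Ffin : finite_set (range s `&` g @^-1` [set x]).
  by apply: finite_setIl; exact: sm.1.
rewrite -fsumEFin//; under eq_fsbigr do rewrite -fibre_lengthE//.
rewrite -measure_fin_bigcup//; last 2 first.
- by move=> z z' _ _ [t [[_ /= <-] [_ /= <-]]].
- by move=> z _; apply: measurableI => //; exact: sm.2.
congr (mu _); apply/seteqP; split=> [t [Dt /= gst]|t [z [_ /= <-] [Dt /= ->]]//].
by exists (s t) => //; split => //; exists t.
Qed.

(** The sum may be taken over the fibres of any finer map [s].  Applied to the
    pair of two simple functions, this gives the linearity of the integral. *)
Lemma simple_integral_comp (T : choiceType) (s : R -> T) (g : T -> V) :
  finite_measurable s ->
  simple_integral a b (fun t => g (s t)) =
    \sum_(z \in range s) sr (fibre_length s z) *: g z.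
Proof.
move=> sm; rewrite /simple_integral.
have sfin : finite_set (range s) := sm.1.
have gfin : finite_set (range (fun t => g (s t))) := (finite_measurable_comp g sm).1.
have Efib x : sr (fine (mu (D `&` (fun t => g (s t)) @^-1` [set x]))) *: x =
    \sum_(z \in range s) (if z \in g @^-1` [set x]
      then sr (fibre_length s z) *: g z else 0).
  rewrite -fsbig_mkcondr -/(fibre_length _ _) fibre_length_comp//.
  rewrite !fsbig_finite; [|exact: finite_setIl..].
  rewrite (big_morph sr (@scalar_of_realD R k) (scalar_of_real0 R k)) scaler_suml.
  apply: eq_big_seq => z; rewrite in_fset_set; last exact: finite_setIl.
  by rewrite inE => -[_ /= ->].
under eq_fsbigr do rewrite Efib.
rewrite exchange_fsbig//; apply: eq_fsbigr => z /set_mem [t _ stz].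
rewrite (fsbigD1 (g z))//=; last by exists t; rewrite ?stz.
rewrite mem_set// fsbig1 ?addr0// => x [_ /= xgz].
by rewrite memNset//= => gzx; apply: xgz.
Qed.

Lemma simple_integral_sub (s s' : R -> V) :
  finite_measurable s -> finite_measurable s' ->
  simple_integral a b (fun t => s t - s' t) =
  simple_integral a b s - simple_integral a b s'.
Proof.
move=> sm s'm; have pm := finite_measurable_pair sm s'm.
rewrite (simple_integral_comp (fun p => p.1 - p.2) pm).
rewrite (simple_integral_comp fst pm) (simple_integral_comp snd pm).
rewrite !fsbig_finite; [|exact: pm.1..].
by rewrite -sumrB; apply: eq_bigr => p _; rewrite scalerBr.
Qed.

Lemma simple_integral_lin (c : scalars R k) (s s' : R -> V) :
  finite_measurable s -> finite_measurable s' ->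
  simple_integral a b (fun t => c *: s t + s' t) =
  c *: simple_integral a b s + simple_integral a b s'.
Proof.
move=> sm s'm; have pm := finite_measurable_pair sm s'm.
rewrite (simple_integral_comp (fun p => c *: p.1 + p.2) pm).
rewrite (simple_integral_comp fst pm) (simple_integral_comp snd pm).
rewrite !fsbig_finite; [|exact: pm.1..].
rewrite scaler_sumr -big_split; apply: eq_bigr => p _ /=.
by rewrite scalerDr !scalerA mulrC.
Qed.

Lemma simple_integral_cst (x : V) :
  simple_integral a b (fun=> x) = sr (fine (mu D)) *: x.
Proof.
rewrite /simple_integral (_ : range _ = [set x]).
  by rewrite fsbig_set1 preimage_cst mem_set// setIT.
by apply/seteqP; split=> [_ [t _ <-]//|_ ->]; exists 0.
Qed.

Lemma integral_finite_measurable (T : choiceType) (s : R -> T) (G : T -> R) :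
  finite_measurable s -> (forall z, 0 <= G z) ->
  (\int[mu]_(t in D) (G (s t))%:E)%E =
    (\sum_(z \in range s) fibre_length s z * G z)%:E.
Proof.
move=> sm G0; have sfin : finite_set (range s) := sm.1.
have mind z : measurable_fun (D : set (measurableTypeR R))
    (fun t => (\1_(s @^-1` [set z]) t)%:E : \bar R).
  by apply/measurable_EFinP; apply: measurable_indic; exact: sm.2.
transitivity (\int[mu]_(t in D) (\sum_(z \in range s)
    ((G z)%:E * (\1_(s @^-1` [set z]) t)%:E))%E)%E.
  apply: eq_integral => t _; rewrite (fsbigD1 (s t))//=; last by exists t.
  rewrite fsbig1 ?adde0//.
    by rewrite indicE mem_set// mule1.
  move=> z [_ /= zst]; rewrite indicE memNset ?mule0//.
  by move=> /= stz; apply: zst.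
rewrite ge0_integral_fsum//; last 2 first.
- move=> z; apply: measurable_funeM; exact: mind.
- by move=> z t _; rewrite mule_ge0// lee_fin.
rewrite -fsumEFin//; apply: eq_fsbigr => z _.
rewrite ge0_integralZl//; last by rewrite lee_fin.
rewrite integral_indic//; last exact: sm.2.
rewrite setIC EFinM muleC; congr (_ * _)%E; exact: fibre_lengthE.
Qed.

Lemma rnorm_simple_integral (s : R -> V) : finite_measurable s ->
  ((rnorm (simple_integral a b s))%:E <=
    \int[mu]_(t in D) (rnorm (s t))%:E)%E.
Proof.
move=> sm; rewrite (integral_finite_measurable sm (G := @rnorm R k V)); last exact: rnorm_ge0.
rewrite lee_fin (simple_integral_comp id sm) !fsbig_finite; [|exact: sm.1..].
elim/big_ind2 : _; first by rewrite rnorm0.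
  by move=> x r x' r' xr xr'; rewrite (le_trans (rnormD _ _))// lerD.
by move=> z _; rewrite rnormZr ger0_norm// fibre_length_ge0.
Qed.

End SimpleIntegral.

(** * Integrals of non-negative real functions *)

Section NonMeasurableIntegral.
Context d (T : measurableType d) (R : realType) (mu : {measure set T -> \bar R}).
Local Open Scope ereal_scope.
Import HBNNSimple.

(** The integral of a non-measurable non-negative function is a supremum over
    the simple functions below it, hence still obeys these two comparisons. *)
Lemma ge0_integral_monotone (D : set T) (f g : T -> \bar R) :
  (forall t, D t -> 0 <= f t) -> (forall t, D t -> f t <= g t) ->
  \int[mu]_(t in D) f t <= \int[mu]_(t in D) g t.
Proof.
move=> f0 fg; rewrite !ge0_integralE//; last by move=> t Dt; rewrite (le_trans (f0 _ Dt))// fg.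
apply: ge_ereal_sup => _ /= [h hf <-]; apply: ereal_sup_ubound; exists h => // t.
rewrite (le_trans (hf t))// !patchE; case: ifPn => // /set_mem; exact: fg.
Qed.

Lemma ge0_integral_ae_monotone (D N : set T) (f g : T -> \bar R) :
  measurable D -> measurable N -> mu N = 0 ->
  (forall t, D t -> 0 <= f t) -> (forall t, 0 <= g t) ->
  measurable_fun D g ->
  (forall t, D t -> ~ N t -> f t <= g t) ->
  \int[mu]_(t in D) f t <= \int[mu]_(t in D) g t.
Proof.
move=> mD mN N0 f0 g0 mg fg; rewrite ge0_integralE//.
apply: ge_ereal_sup => _ /= [h hf <-].
rewrite -integralT_nnsfun (integral_mkcond D); apply: ae_ge0_le_integral => //.
- by move=> t _; rewrite lee_fin.
- exact/measurable_EFinP/measurable_funP.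
- by move=> t _; rewrite patchE; case: ifPn.
- exact/(measurable_restrictT _ mD).
- exists N; split => // t /= ht; apply: contrapT => Nt; apply: ht => _.
  by rewrite (le_trans (hf t))// !patchE; case: ifPn => // /set_mem Dt; exact: fg.
Qed.

End NonMeasurableIntegral.

Section BoundedConvergence.
Context (R : realType) (a b : R).
Local Notation mu := (@lebesgue_measure R).
Local Notation D := (`[a, b]%classic : set (measurableTypeR R)).

Lemma lebesgue_measure_itvcc_fin : mu D = (fine (mu D))%:E.
Proof.
by rewrite fineK// lebesgue_measure_itv; case: ifPn.
Qed.

Lemma limn_einf_ge (u : nat -> \bar R) (x : \bar R) n0 :
  (forall n, (n0 <= n)%N -> (x <= u n)%E) -> (x <= limn_einf u)%E.
Proof.
move=> xu; rewrite /limn_einf /limf_einf leeNr; apply: ereal_inf_le => /=.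
exists (ereal_sup ((\- u)%E @` [set n | (n0 <= n)%N])).
  by exists [set n | (n0 <= n)%N]; [exists n0|].
by apply: ge_ereal_sup => _ [n /= n0n <-]; rewrite leeN2 xu.
Qed.

Lemma limn_einf_le (u : nat -> \bar R) (x : \bar R) :
  (forall n, (u n <= x)%E) -> (limn_einf u <= x)%E.
Proof.
move=> ux; rewrite /limn_einf /limf_einf leeNl; apply: le_ereal_inf_tmp.
move=> _ [A [n _ nA] <-]; apply: (@le_trans _ _ (- u n)%E); first by rewrite leeN2.
by apply: ereal_sup_ubound; exists n; [by apply: nA => /=|].
Qed.

Lemma measurable_fun_limn_einf (E : set (measurableTypeR R))
    (f : nat -> measurableTypeR R -> \bar R) :
  (forall n, measurable_fun E (f n)) ->
  measurable_fun E (fun t => limn_einf (f ^~ t)).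
Proof.
move=> mf; apply: measurableT_comp => //.
by apply: measurable_fun_limn_esup => n; exact: measurableT_comp.
Qed.

(** Fatou's lemma in each of the two indices, applied to [C - G m n].  Only the
    iterated upper limit of [G] is controlled, and without any measurability of
    the thresholds in [t]. *)
Lemma iterated_bounded_convergence (C : R) (G : nat -> nat -> R -> R) :
  (forall m n, measurable_fun D (G m n : measurableTypeR R -> R)) ->
  (forall m n t, 0 <= G m n t <= C) ->
  (forall t, t \in `[a, b] -> forall e, 0 < e -> exists m0, forall m, (m0 <= m)%N ->
     exists n0, forall n, (n0 <= n)%N -> G m n t <= e) ->
  forall e, 0 < e -> exists m n, (\int[mu]_(t in D) (G m n t)%:E < e%:E)%E.
Proof.
move=> mG GC G0 e e0; apply: contrapT => Gge.
have mD : measurable D by exact: measurable_itv.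
have {}Gge m n : (e%:E <= \int[mu]_(t in D) (G m n t)%:E)%E.
  by rewrite leNgt; apply/negP => Glt; apply: Gge; exists m, n.
pose c := C * fine (mu D).
have intC : (\int[mu]_(t in D) C%:E)%E = c%:E.
  rewrite integral_cst// EFinM; congr (_ * _)%E.
  exact: lebesgue_measure_itvcc_fin.
pose F m n t := (C - G m n t)%:E.
have F0 m n t : (0 <= F m n t)%E.
  by rewrite lee_fin subr_ge0; case/andP: (GC m n t).
have mF m n : measurable_fun D (F m n : measurableTypeR R -> \bar R).
  by apply/measurable_EFinP; exact: measurable_funB.
have intF m n : (\int[mu]_(t in D) F m n t <= (c - e)%:E)%E.
  have G_ge0 t : D t -> (0 <= (G m n t)%:E)%E.
    by move=> _; rewrite lee_fin; case/andP: (GC m n t).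
  have : (\int[mu]_(t in D) F m n t + \int[mu]_(t in D) (G m n t)%:E = c%:E)%E.
    rewrite -ge0_integralD//; last exact/measurable_EFinP.
    by rewrite -intC; apply: eq_integral => t _; rewrite /F -EFinD subrK.
  move=> Fc; have Gfin : (\int[mu]_(t in D) (G m n t)%:E)%E \is a fin_num.
    rewrite ge0_fin_numE ?integral_ge0//.
    rewrite (@le_lt_trans _ _ c%:E) ?ltry// -Fc leeDr// integral_ge0//.
  by rewrite EFinB -Fc leeBrDr// leeD2l.
pose L m t := limn_einf (fun n => F m n t).
have mL m : measurable_fun D (L m : measurableTypeR R -> \bar R).
  exact: measurable_fun_limn_einf.
have L0 m t : (0 <= L m t)%E by apply: (@limn_einf_ge _ _ 0%N) => n _.
have intL m : (\int[mu]_(t in D) L m t <= (c - e)%:E)%E.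
  apply: le_trans (fatou mu mD (mF m) _) _ => //.
  by apply: limn_einf_le => n.
have : (\int[mu]_(t in D) C%:E <= (c - e)%:E)%E.
  apply: (@le_trans _ _ (\int[mu]_(t in D) limn_einf (fun m => L m t))%E).
    apply: ge0_integral_monotone => t Dt.
      rewrite lee_fin; case/andP: (GC 0%N 0%N t); exact: le_trans.
    apply/lee_addgt0Pr => r r0; have [m0 m0P] := G0 t Dt _ r0.
    rewrite -leeBlDr//; apply: (@limn_einf_ge _ _ m0) => m m0m.
    have [n0 n0P] := m0P _ m0m; apply: (@limn_einf_ge _ _ n0) => n n0n.
    by rewrite -EFinB lee_fin lerB// n0P.
  apply: le_trans (fatou mu mD mL _) _ => //.
  exact: limn_einf_le.
by rewrite intC lee_fin lerBrDr gerDl leNgt e0.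
Qed.

Lemma bounded_convergence (C : R) (G : nat -> R -> R) :
  (forall n, measurable_fun D (G n : measurableTypeR R -> R)) ->
  (forall n t, 0 <= G n t <= C) ->
  (forall t, G n t @[n --> \oo] --> 0) ->
  forall e : R, 0 < e -> \forall n \near \oo, (\int[mu]_(t in D) (G n t)%:E <= e%:E)%E.
Proof.
move=> mG GC G0 e e0.
have mD : measurable D by exact: measurable_itv.
have := @dominated_convergence _ _ R mu D mD (fun n t => (G n t)%:E)
  (cst 0%E) (cst C%:E).
case.
- by move=> n; exact/measurable_EFinP.
- exact: measurable_cst.
- by apply: aeW => t _; apply: cvg_EFin; [exact: nearW|exact: G0].
- apply/integrableP; split; first exact: measurable_cst.
  rewrite (@integral_cst _ _ _ _ _ _ `|C|%:E)//.
  have /= -> := lebesgue_measure_itvcc_fin.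
  by rewrite -EFinM ltry.
- apply: aeW => t n _; rewrite lee_fin.
  by case/andP: (GC n t) => G_ge0 ?; rewrite ger0_norm.
move=> _ _; rewrite integral0 => /fine_cvgP[fin /cvgrPdist_le /(_ _ e0) G_le].
near=> n; rewrite -[leLHS]fineK; last by near: n.
rewrite lee_fin; apply: le_trans (ler_norm _) _.
by rewrite -normrN -sub0r; near: n.
Unshelve. all: by end_near. Qed.

End BoundedConvergence.

(** * Bochner integrals of bounded functions *)

Section SimpleLimit.
Context (R : realType) (k : scalar_kind) (V : completeNormedModType (scalars R k)).
Local Notation mu := (@lebesgue_measure R).
Context (a b : R).
Local Notation D := (`[a, b]%classic : set (measurableTypeR R)).

Definition simple_limit (s : nat -> R -> V) (g : R -> V) (C : R) : Prop :=
  [/\ forall n, finite_measurable (s n), forall n t, rnorm (s n t) <= C &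
      forall t, s n t @[n --> \oo] --> g t].

Context (s : nat -> R -> V) (g : R -> V) (C : R) (sgC : simple_limit s g C).

Lemma simple_limit_ge0 : 0 <= C.
Proof. by case: sgC => _ /(_ 0%N 0) + _; apply: le_trans; exact: rnorm_ge0. Qed.

Lemma simple_limit_bound t : rnorm (g t) <= C.
Proof.
case: sgC => _ sC /(_ t) /rnorm_cvg sg; apply: (cvgr_to_le sg).
by apply: nearW => n; exact: sC.
Qed.

Lemma simple_limit_rnorm_sub_measurable (r : R -> V) (E : set (measurableTypeR R)) :
  finite_measurable r ->
  measurable_fun E (fun t : measurableTypeR R => rnorm (r t - g t)).
Proof.
case: sgC => sm _ sg rm.
apply: (measurable_fun_cvg (h := fun n t => rnorm (r t - s n t))) => [n|t _].
  apply: (finite_measurable_measurable_fun (s := fun t => rnorm (r t - s n t))).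
  exact: (finite_measurable_comp (fun p => rnorm (p.1 - p.2)) (finite_measurable_pair rm (sm n))).
apply: (@rnorm_cvg R k V nat \oo _ (fun n => r t - s n t) (r t - g t)).
by apply: cvgB; [exact: cvg_cst|exact: sg].
Qed.

Lemma simple_limit_rnorm_measurable (E : set (measurableTypeR R)) :
  measurable_fun E (fun t : measurableTypeR R => rnorm (g t)).
Proof.
have := @simple_limit_rnorm_sub_measurable (fun=> 0) E (@finite_measurable_cst R V 0).
by under eq_fun do rewrite sub0r rnormN.
Qed.

Lemma simple_limit_L1 (e : R) : 0 < e ->
  \forall n \near \oo, (\int[mu]_(t in D) (rnorm (s n t - g t))%:E <= e%:E)%E.
Proof.
move=> e0; case: (sgC) => sm sC sg.
apply: (@bounded_convergence R a b (C + C) (fun n t => rnorm (s n t - g t))) => //.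
- by move=> n; exact: simple_limit_rnorm_sub_measurable.
- move=> n t; rewrite rnorm_ge0/= (le_trans (rnormB _ _))// lerD//.
  exact: simple_limit_bound.
- move=> t; rewrite -[X in _ --> X](@rnorm0 R k V) -(subrr (g t)).
  apply: (@rnorm_cvg R k V nat \oo _ (fun n => s n t - g t)).
  by apply: cvgB; [exact: sg|exact: cvg_cst].
Qed.

Lemma rnorm_simple_integral_sub (r r' : R -> V) :
  finite_measurable r -> finite_measurable r' ->
  ((rnorm (simple_integral a b r - simple_integral a b r'))%:E <=
   \int[mu]_(t in D) (rnorm (r t - g t))%:E +
   \int[mu]_(t in D) (rnorm (r' t - g t))%:E)%E.
Proof.
move=> rm r'm; rewrite -simple_integral_sub//.
have mD : measurable D by exact: measurable_itv.
apply: le_trans (rnorm_simple_integral _ _ _) _.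
  exact: (finite_measurable_comp (fun p => p.1 - p.2) (finite_measurable_pair rm r'm)).
rewrite -ge0_integralD//.
- apply: ge0_integral_monotone => t _; first by rewrite lee_fin rnorm_ge0.
  rewrite -EFinD lee_fin (_ : r t - r' t = (r t - g t) - (r' t - g t)) ?rnormB//.
  by rewrite opprB addrA subrK.
- by move=> t _; rewrite lee_fin rnorm_ge0.
- by apply/measurable_EFinP; exact: simple_limit_rnorm_sub_measurable.
- by move=> t _; rewrite lee_fin rnorm_ge0.
- by apply/measurable_EFinP; exact: simple_limit_rnorm_sub_measurable.
Qed.

Lemma simple_limit_integral_cvg :
  exists x : V, simple_integral a b (s n) @[n --> \oo] --> x.
Proof.
case: (sgC) => sm _ _.
apply: rnorm_cauchy_cvg => e e0.
have [N _ NP] := simple_limit_L1 (divr_gt0 e0 (ltr0Sn R 1)).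
exists N => m n Nm Nn; rewrite -lee_fin.
apply: le_trans (rnorm_simple_integral_sub (sm m) (sm n)) _.
by rewrite [e in leRHS]splitr EFinD leeD// NP.
Qed.

(** The functions [r n] are only supposed to converge in mean: this compares an
    arbitrary approximating sequence with a uniformly bounded one. *)
Lemma simple_limit_integral_unique (r : nat -> R -> V) (x y : V) :
  (forall n, finite_measurable (r n)) ->
  (forall e : R, 0 < e ->
    \forall n \near \oo, (\int[mu]_(t in D) (rnorm (r n t - g t))%:E <= e%:E)%E) ->
  simple_integral a b (r n) @[n --> \oo] --> x ->
  simple_integral a b (s n) @[n --> \oo] --> y -> x = y.
Proof.
move=> rm rg rx sy; apply/eqP; rewrite -subr_eq0; apply/eqP/rnorm_eq0/eqP.
rewrite eq_le rnorm_ge0 andbT; apply/ler_addgt0Pr => e e0; rewrite add0r.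
have /rnorm_cvg rsxy : simple_integral a b (r n) - simple_integral a b (s n) @[n --> \oo]
  --> x - y by exact: cvgB rx sy.
apply: (cvgr_to_le rsxy).
near=> n; rewrite -lee_fin.
apply: le_trans (rnorm_simple_integral_sub (rm n) _) _; first by case: sgC.
rewrite [e]splitr EFinD leeD//; near: n.
  by apply: rg; rewrite divr_gt0.
by apply: simple_limit_L1; rewrite divr_gt0.
Unshelve. all: by end_near. Qed.

Lemma rnorm_simple_limit_integral (x : V) :
  simple_integral a b (s n) @[n --> \oo] --> x ->
  ((rnorm x)%:E <= \int[mu]_(t in D) (rnorm (g t))%:E)%E.
Proof.
move=> sx; case: (sgC) => sm _ _; apply/lee_addgt0Pr => e e0.
have mD : measurable D by exact: measurable_itv.
have fin : (\int[mu]_(t in D) (rnorm (g t))%:E)%E \is a fin_num.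
  rewrite ge0_fin_numE; last by apply: integral_ge0 => t _; rewrite lee_fin rnorm_ge0.
  apply: (@le_lt_trans _ _ (\int[mu]_(t in D) C%:E)%E).
    apply: ge0_integral_monotone => t _; rewrite lee_fin ?rnorm_ge0//.
    exact: simple_limit_bound.
  rewrite integral_cst//; have /= -> := lebesgue_measure_itvcc_fin a b.
  by rewrite -EFinM ltry.
rewrite -(fineK fin) -EFinD lee_fin.
move/rnorm_cvg in sx; apply: (cvgr_to_le sx).
near=> n; rewrite -lee_fin EFinD fineK//.
apply: le_trans (rnorm_simple_integral _ _ (sm n)) _.
apply: (@le_trans _ _ (\int[mu]_(t in D) (rnorm (g t))%:E +
    \int[mu]_(t in D) (rnorm (s n t - g t))%:E)%E).
  rewrite -ge0_integralD//.
  - apply: ge0_integral_monotone => t _; first by rewrite lee_fin rnorm_ge0.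
    by rewrite -EFinD lee_fin -{1}(subrKC (g t) (s n t)) rnormD.
  - by move=> t _; rewrite lee_fin rnorm_ge0.
  - by apply/measurable_EFinP; exact: simple_limit_rnorm_measurable.
  - by move=> t _; rewrite lee_fin rnorm_ge0.
  - by apply/measurable_EFinP; exact: simple_limit_rnorm_sub_measurable.
by rewrite leeD2l//; near: n; exact: simple_limit_L1.
Unshelve. all: by end_near. Qed.

End SimpleLimit.

Section BoundedBochner.
Context (R : realType) (k : scalar_kind) (V : completeNormedModType (scalars R k)).
Local Notation mu := (@lebesgue_measure R).
Local Notation borel A := (measurable (A : set (measurableTypeR R))).
Local Notation sr := (@scalar_of_real R k).
Implicit Types (a b : R) (f g : R -> V) (x y : V).

(** Passing from [f] to the everywhere limit [g] makes all norms Borel measurable,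
    and the uniform bound [C] makes the integrals converge. *)
Definition is_bounded_integral a b f x : Prop :=
  exists s g C N, [/\ simple_limit s g C, borel N, mu N = 0,
    (forall t, a <= t <= b -> ~ N t -> f t = g t) &
    simple_integral a b (s n) @[n --> \oo] --> x].

Definition ae_simple_limit a b f : Prop :=
  exists s N, [/\ forall n, finite_measurable (s n), borel N, mu N = 0 &
    forall t, a <= t <= b -> ~ N t -> s n t @[n --> \oo] --> f t].

Lemma bochner_integrable_ae_simple_limit a b f :
  bochner_integrable a b f -> ae_simple_limit a b f.
Proof.
move=> [s [sm [N [mN N0 sN]] _]]; exists s, N; split => // t tab Nt.
apply: contrapT => sft; apply: Nt; apply: sN => /= H; apply: sft; apply: H.
by rewrite /= in_itv.
Qed.

(** Replacing by zero the values of norm above [`|C| + 1] affects each point for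
    finitely many indices only, since [C] bounds the limit. *)
Lemma bounded_integral_exists a b f C :
  ae_simple_limit a b f -> (forall t, a <= t <= b -> rnorm (f t) <= C) ->
  exists x, is_bounded_integral a b f x.
Proof.
move=> [s [N [sm mN N0 sf]]] fC.
pose A := `[a, b]%classic `&` ~` N : set (measurableTypeR R).
have mA : measurable A by apply: measurableI; [exact: measurable_itv|exact: measurableC].
pose s' n t := if (t \in A) && (rnorm (s n t) <= `|C| + 1) then s n t else 0.
pose g t := if t \in A then f t else 0.
have s'g : simple_limit s' g (`|C| + 1).
  split=> [n|n t|t]; rewrite /s' /g.
  - apply: (finite_measurable_comp (fun p : bool * V =>
      if p.1 && (rnorm p.2 <= `|C| + 1) then p.2 else 0)
      (s := fun t => (t \in A, s n t))).
    by apply: finite_measurable_pair => //; exact: finite_measurable_mem.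
  - by case: ifP => [/andP[]//|_]; rewrite rnorm0 addr_ge0.
  - case: ifPn => /=; last by move=> _; exact: cvg_cst.
    rewrite inE => -[/=]; rewrite in_itv/= => tab Nt.
    have sft := sf _ tab Nt.
    have /cvgr_le : rnorm (s n t) @[n --> \oo] --> rnorm (f t) by exact: rnorm_cvg.
    move=> /(_ (`|C| + 1)) h; apply: cvg_trans sft; apply: near_eq_cvg; near=> n; rewrite ifT//; near: n; apply: h.
    by rewrite (le_lt_trans (fC _ tab))// (le_lt_trans (ler_norm _))// ltrDl.
have [x s'x] := simple_limit_integral_cvg a b s'g.
exists x, s', g, (`|C| + 1), N; split => // t tab Nt.
by rewrite /g mem_set//; split => //=; rewrite in_itv.
Unshelve. all: by end_near. Qed.

Lemma is_bounded_integral_bochner a b f x :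
  is_bounded_integral a b f x -> is_bochner_integral a b f x.
Proof.
move=> [s [g [C [N [sg mN N0 fg sx]]]]]; exists s => //.
have mD : measurable (`[a, b]%classic : set (measurableTypeR R)) by exact: measurable_itv.
split.
- by case: sg => sm _ _ n; exact: sm.
- exists N; split => // t /= ht; apply: contrapT => Nt; apply: ht.
  by rewrite /= in_itv/= => tab; rewrite fg//; case: sg.
- have fin n : (\int[mu]_(t in `[a, b]) (rnorm (f t - s n t))%:E <=
      \int[mu]_(t in `[a, b]) (rnorm (s n t - g t))%:E)%E.
    apply: (ge0_integral_ae_monotone (N := N)) => //.
    + by move=> t _; rewrite lee_fin rnorm_ge0.
    + by move=> t; rewrite lee_fin rnorm_ge0.
    + apply/measurable_EFinP; apply: simple_limit_rnorm_sub_measurable; first exact: sg.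
      by case: sg.
    + by move=> t /=; rewrite in_itv/= => tab Nt; rewrite fg// rnorm_distC.
  apply/fine_cvgP; split.
    have [n0 _ n0P] := simple_limit_L1 a b sg ltr01.
    exists n0 => // n n0n; rewrite ge0_fin_numE.
      by rewrite (le_lt_trans (fin n))// (le_lt_trans (n0P _ n0n))// ltry.
    by apply: integral_ge0 => t _; rewrite lee_fin rnorm_ge0.
  apply/cvgrPdist_le => e e0.
  apply: filterS (simple_limit_L1 a b sg e0) => n /= ge.
  have ie := le_trans (fin n) ge.
  have i0 : (0 <= \int[mu]_(t in `[a, b]) (rnorm (f t - s n t))%:E)%E.
    by apply: integral_ge0 => t _; rewrite lee_fin rnorm_ge0.
  rewrite sub0r normrN ger0_norm; last exact: fine_ge0.
  rewrite -lee_fin fineK// ge0_fin_numE//.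
  by rewrite (le_lt_trans ie)// ltry.
Qed.

Lemma bounded_integralE a b f x :
  is_bounded_integral a b f x -> bochner_integral a b f = x.
Proof.
move=> fx; have fx' := is_bounded_integral_bochner fx.
rewrite /bochner_integral; apply: xget_unique => // y [r [rm _ rf0] ry].
case: fx => s [g [C [N [sg mN N0 fg sx]]]].
apply: (simple_limit_integral_unique sg _ _ ry sx) => // e e0.
have mD : measurable (`[a, b]%classic : set (measurableTypeR R)) by exact: measurable_itv.
have le n : (\int[mu]_(t in `[a, b]) (rnorm (r n t - g t))%:E <=
    \int[mu]_(t in `[a, b]) (rnorm (f t - r n t))%:E)%E.
  pose w t := if t \in (~` N : set (measurableTypeR R)) then rnorm (r n t - g t) else 0.
  apply: (@le_trans _ _ (\int[mu]_(t in `[a, b]) (w t)%:E)%E); last first.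
    apply: ge0_integral_monotone => t /=; rewrite /w lee_fin.
      by move=> _; case: ifP => // _; exact: rnorm_ge0.
    rewrite in_itv/= => tab; case: ifPn => [|_]; last exact: rnorm_ge0.
    by rewrite inE => Nt; rewrite rnorm_distC fg.
  apply: (ge0_integral_ae_monotone (N := N)) => //.
  - by move=> t _; rewrite lee_fin rnorm_ge0.
  - by move=> t; rewrite /w lee_fin; case: ifP => // _; exact: rnorm_ge0.
  - apply/measurable_EFinP; rewrite /w.
    rewrite (_ : (fun t => _) = (fun t => rnorm (r n t - g t)) \* \1_(~` N)).
      apply: measurable_funM; first by apply: simple_limit_rnorm_sub_measurable; [exact: sg|exact: rm].
      by apply: measurable_indic; exact: measurableC.
    by apply/funext => t /=; rewrite indicE; case: ifP => _; rewrite ?mulr1 ?mulr0.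
  - by move=> t _ Nt; rewrite /w mem_set.
move: rf0 => /fine_cvgP[fin /cvgrPdist_le /(_ _ e0) re].
near=> n; apply: le_trans (le n) _.
rewrite -[leLHS]fineK; last by near: n.
rewrite lee_fin; apply: le_trans (ler_norm _) _.
by rewrite -normrN -sub0r; near: n.
Unshelve. all: by end_near. Qed.

End BoundedBochner.

(** * Linearity, translation and bounds of the integral *)

Section SimpleIntegralDomain.
Context (R : realType) (k : scalar_kind) (V : normedModType (scalars R k)).
Local Notation mu := (@lebesgue_measure R).
Implicit Types (a b c d r : R) (s : R -> V).

Lemma simple_integral_addr a b r s : finite_measurable s ->
  simple_integral a b (fun t => s (r + t)) = simple_integral (r + a) (r + b) s.
Proof.
move=> sm; rewrite /simple_integral (_ : range (fun t => s (r + t)) = range s).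
  apply: eq_fsbigr => x _; congr (scalar_of_real k (fine _) *: x).
  rewrite -[RHS](lebesgue_measure_addr r); last first.
    by apply: measurableI; [exact: measurable_itv|exact: sm.2].
  congr (mu _); apply/seteqP; split=> t [] /=; rewrite !in_itv/= => /andP[? ?] ?.
    by split => //; rewrite !lerD2l; apply/andP.
  by split => //; lra.
apply/seteqP; split=> _ [t _ <-]; first by exists (r + t).
by exists (t - r) => //; rewrite addrC subrK.
Qed.

Lemma simple_integral_restrict a b c d s : a <= c -> d <= b ->
  finite_measurable s ->
  simple_integral a b (fun t => if t \in `[c, d] then s t else 0) =
  simple_integral c d s.
Proof.
move=> ac db sm; pose s' t := if t \in `[c, d] then s t else 0.
have wide p q (u : R -> V) : range u `<=` range s `|` [set 0] ->
    simple_integral p q u = \sum_(x \in range s `|` [set 0])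
      scalar_of_real k (fine (mu (`[p, q] `&` u @^-1` [set x]))) *: x.
  move=> uF; rewrite /simple_integral; apply: fsbig_widen => // x [_ /= xu].
  rewrite (_ : _ `&` _ = set0) ?measure0 ?scalar_of_real0 ?scale0r//.
  by apply/seteqP; split=> // t [_ /= utx]; apply: xu; exists t.
rewrite !wide; [|by move=> x; left|]; last first.
  by move=> _ [t _ <-]; case: ifP => _; [left; exists t|right].
apply: eq_fsbigr => x _; have [->|x0] := eqVneq x 0; first by rewrite !scaler0.
congr (scalar_of_real k (fine (mu _)) *: x); apply/seteqP; split=> t [] /=.
  move=> _; case: ifPn => [//|_ x0'].
  by rewrite -x0' eqxx in x0.
move=> tcd <-; rewrite tcd; split => //; move: tcd; rewrite !in_itv/= => /andP[? ?].
by apply/andP; split; lra.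
Qed.

End SimpleIntegralDomain.

Section BoundedBochnerTheory.
Context (R : realType) (k : scalar_kind) (V : completeNormedModType (scalars R k)).
Local Notation mu := (@lebesgue_measure R).
Local Notation borel A := (measurable (A : set (measurableTypeR R))).
Local Notation sr := (@scalar_of_real R k).
Implicit Types (a b : R) (f g : R -> V) (x y : V).

Lemma eq_bounded_integral a b f g x :
  (forall t, a <= t <= b -> f t = g t) ->
  is_bounded_integral a b f x -> is_bounded_integral a b g x.
Proof.
move=> fg [s [h [C [N [sh mN N0 fh sx]]]]]; exists s, h, C, N; split => // t tab Nt.
by rewrite -fg// fh.
Qed.

Lemma bounded_integral_lin a b (c : scalars R k) f g x y :
  is_bounded_integral a b f x -> is_bounded_integral a b g y ->
  is_bounded_integral a b (fun t => c *: f t + g t) (c *: x + y).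
Proof.
move=> [s [f' [C [N [[sm sC sf'] mN N0 ff' sx]]]]].
move=> [r [g' [C' [N' [[rm rC' rg'] mN' N'0 gg' ry]]]]].
exists (fun n t => c *: s n t + r n t), (fun t => c *: f' t + g' t),
  (rnorm (c : (scalars R k)^o) * C + C'), (N `|` N'); split.
- split=> [n|n t|t].
  + exact: (finite_measurable_comp (fun p => c *: p.1 + p.2) (finite_measurable_pair (sm n) (rm n))).
  + by rewrite (le_trans (rnormD _ _))// lerD// rnormZ ler_wpM2l// rnorm_ge0.
  + by apply: cvgD; [apply: cvgZl_tmp; exact: sf'|exact: rg'].
- exact: measurableU.
- by apply: etrans N0; exact: measureU0.
- by move=> t tab /not_orP[Nt N't]; rewrite ff'// gg'.
- under eq_fun do rewrite simple_integral_lin//.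
  by apply: cvgD => //; exact: cvgZl_tmp.
Qed.

Lemma bounded_integralB a b f g x y :
  is_bounded_integral a b f x -> is_bounded_integral a b g y ->
  is_bounded_integral a b (fun t => f t - g t) (x - y).
Proof.
move=> fx gy; have := bounded_integral_lin (-1) gy fx.
rewrite scaleN1r addrC; apply: eq_bounded_integral => t _.
by rewrite scaleN1r addrC.
Qed.

Lemma bounded_integralZ a b (c : scalars R k) f x :
  is_bounded_integral a b f x ->
  is_bounded_integral a b (fun t => c *: f t) (c *: x).
Proof.
move=> fx; have := bounded_integral_lin (c - 1) fx fx.
rewrite scalerBl scale1r subrK.
by apply: eq_bounded_integral => t _; rewrite scalerBl scale1r subrK.
Qed.

Lemma bounded_integral_cst a b x : a <= b ->
  is_bounded_integral a b (fun=> x) (sr (b - a) *: x).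
Proof.
move=> ab; exists (fun _ _ => x), (fun=> x), (rnorm x), set0; split => //.
- by split=> [n|//|t]; [exact: finite_measurable_cst|exact: cvg_cst].
- rewrite simple_integral_cst lebesgue_measure_itv/= lte_fin.
  have [_|ba] := ltP a b; first exact: cvg_cst.
  by rewrite (@le_anti _ _ a b) ?ab ?ba// subrr; exact: cvg_cst.
Qed.

Lemma bounded_integral_addr a b r f x :
  is_bounded_integral (r + a) (r + b) f x ->
  is_bounded_integral a b (fun t => f (r + t)) x.
Proof.
move=> [s [g [C [N [[sm sC sg] mN N0 fg sx]]]]].
exists (fun n t => s n (r + t)), (fun t => g (r + t)), C, [set t | N (r + t)].
split.
- by split=> [n|n t|t]; [exact: finite_measurable_addr|exact: sC|exact: sg].
- exact: borel_addr.
- by rewrite lebesgue_measure_addr.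
- by move=> t tab Nt; rewrite fg// !lerD2l.
- by under eq_fun do rewrite simple_integral_addr//.
Qed.

(** Both integrals are limits along the same simple functions.  This takes the
    place of additivity with respect to the interval: two windows can be compared
    inside a common larger interval. *)
Lemma bounded_integral_restrict a b c d f x : a <= c -> d <= b ->
  is_bounded_integral a b f x -> exists y,
  is_bounded_integral a b (fun t => if t \in `[c, d] then f t else 0) y /\
  is_bounded_integral c d f y.
Proof.
move=> ac db [s [g [C [N [sg mN N0 fg _]]]]].
have [y sy] := simple_limit_integral_cvg c d sg; case: (sg) => sm sC sgt.
exists y; split; last first.
  by exists s, g, C, N; split => // t /andP[ct td] Nt; apply: fg => //; lra.
exists (fun n t => if t \in `[c, d] then s n t else 0),
  (fun t => if t \in `[c, d] then g t else 0), C, N; split => //.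
- split=> [n|n t|t].
  + apply: (finite_measurable_comp (fun p : bool * V => if p.1 then p.2 else 0)
      (s := fun t => (t \in `[c, d], s n t))).
    apply: finite_measurable_pair => //.
    rewrite (_ : (fun t => t \in `[c, d]) = (fun t => t \in `[c, d]%classic)).
      by apply: finite_measurable_mem; exact: measurable_itv.
    by apply/funext => t; rewrite mem_setE.
  + by case: ifP => // _; rewrite rnorm0 (simple_limit_ge0 sg).
  + by case: ifP => _; [exact: sgt|exact: cvg_cst].
- by move=> t tab Nt; case: ifP => // _; exact: fg.
- by under eq_fun do rewrite simple_integral_restrict//.
Qed.

Lemma bounded_integral_le a b f x (G : R -> R) :
  is_bounded_integral a b f x ->
  measurable_fun (`[a, b]%classic : set (measurableTypeR R)) (G : measurableTypeR R -> R) ->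
  (forall t, 0 <= G t) ->
  (forall t, a <= t <= b -> rnorm (f t) <= G t) ->
  ((rnorm x)%:E <= \int[mu]_(t in `[a, b]) (G t)%:E)%E.
Proof.
move=> [s [g [C [N [sg mN N0 fg sx]]]]] mG G0 fG.
apply: le_trans (rnorm_simple_limit_integral sg sx) _.
have mD : borel `[a, b]%classic by exact: measurable_itv.
apply: (ge0_integral_ae_monotone (N := N)) => //.
- by move=> t _; rewrite lee_fin rnorm_ge0.
- exact/measurable_EFinP.
- by move=> t /=; rewrite in_itv/= lee_fin => tab Nt; rewrite -fg// fG.
Qed.

Lemma bounded_integral_le_cst a b f x C : a <= b ->
  is_bounded_integral a b f x ->
  (forall t, a <= t <= b -> rnorm (f t) <= C) -> rnorm x <= (b - a) * C.
Proof.
move=> ab fx fC; rewrite -lee_fin.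
have C0 : 0 <= C by apply: le_trans (fC a _); rewrite ?lexx ?ab// rnorm_ge0.
apply: le_trans (bounded_integral_le (G := fun=> C) fx _ _ fC) _ => //.
rewrite integral_cst//=.
rewrite lebesgue_measure_itv/= lte_fin muleC EFinM.
have [_|ba] := ltP a b; first by rewrite -EFinB.
by rewrite mul0e (@le_anti _ _ a b) ?ab ?ba// subrr mul0e.
Qed.

(** The Borel minorant [G] of the norm of [f] still bounds the integral, because
    it differs from that norm only on a null set, where it vanishes. *)
Lemma rnorm_bounded_integral_minorant a b f x C : 0 <= C ->
  is_bounded_integral a b f x ->
  (forall t, a <= t <= b -> rnorm (f t) <= C) ->
  exists G : R -> R, [/\
    measurable_fun (`[a, b]%classic : set (measurableTypeR R)) (G : measurableTypeR R -> R),
    forall t, 0 <= G t <= C, forall t, a <= t <= b -> G t <= rnorm (f t) &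
    ((rnorm x)%:E <= \int[mu]_(t in `[a, b]) (G t)%:E)%E].
Proof.
move=> C0 [s [g [C' [N [sg mN N0 fg sx]]]]] fC.
have mD : borel `[a, b]%classic by exact: measurable_itv.
pose G t := Num.min (rnorm (g t)) C * (\1_(~` N) t : R).
have G0C t : 0 <= G t <= C.
  rewrite /G indicE; case: (t \in ~` N); rewrite ?mulr1 ?mulr0 ?lexx//=.
  by rewrite ge_min lexx orbT andbT le_min rnorm_ge0.
have mG : measurable_fun (`[a, b]%classic : set (measurableTypeR R)) (G : measurableTypeR R -> R).
  apply: measurable_funM.
    by apply: measurable_minr => //; exact: simple_limit_rnorm_measurable sg _.
  by apply: measurable_indic; exact: measurableC.
have GfN t : a <= t <= b -> ~ N t -> G t = rnorm (f t).
  move=> tab Nt; rewrite /G indicE mem_set// mulr1 -fg//.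
  by apply/min_idPl; exact: fC.
exists G; split => // [t tab|].
  have [Nt|Nt] := pselect (N t); last by rewrite GfN.
  rewrite /G indicE memNset ?mulr0 ?rnorm_ge0//; exact.
apply: le_trans (rnorm_simple_limit_integral sg sx) _.
apply: (ge0_integral_ae_monotone (N := N)) => //.
- by move=> t _; rewrite lee_fin rnorm_ge0.
- by move=> t; rewrite lee_fin; case/andP: (G0C t).
- exact/measurable_EFinP.
- by move=> t /=; rewrite in_itv/= lee_fin => tab Nt; rewrite GfN// fg.
Qed.

(** The thresholds [m0] and [n0] may depend on [t] in an arbitrary way: this is
    what dispenses with a measurable choice of decompositions. *)
Lemma iterated_bounded_integral_small a b (f : nat -> nat -> R -> V)
    (x : nat -> nat -> V) C : 0 <= C ->
  (forall m n, is_bounded_integral a b (f m n) (x m n)) ->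
  (forall m n t, a <= t <= b -> rnorm (f m n t) <= C) ->
  (forall t, a <= t <= b -> forall e, 0 < e -> exists m0, forall m, (m0 <= m)%N ->
     exists n0, forall n, (n0 <= n)%N -> rnorm (f m n t) <= e) ->
  forall e, 0 < e -> exists m n, rnorm (x m n) < e.
Proof.
move=> C0 fx fC f0 e e0.
have /choice[G GP] : forall p : nat * nat, exists G : R -> R, [/\
    measurable_fun (`[a, b]%classic : set (measurableTypeR R)) (G : measurableTypeR R -> R),
    forall t, 0 <= G t <= C, forall t, a <= t <= b -> G t <= rnorm (f p.1 p.2 t) &
    ((rnorm (x p.1 p.2))%:E <= \int[mu]_(t in `[a, b]) (G t)%:E)%E].
  move=> [m n]; exact: rnorm_bounded_integral_minorant C0 (fx m n) (fC m n).
suff [m [n Gmn]] : exists m n, (\int[mu]_(t in `[a, b]) (G (m, n) t)%:E < e%:E)%E.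
  by exists m, n; rewrite -lte_fin; apply: le_lt_trans Gmn; case: (GP (m, n)).
apply: (@iterated_bounded_convergence R a b C (fun m n => G (m, n))) => //.
- by move=> m n; case: (GP (m, n)).
- by move=> m n t; case: (GP (m, n)).
move=> t; rewrite in_itv/= => tab r r0; have [m0 m0P] := f0 t tab r r0.
exists m0 => m /m0P[n0 n0P]; exists n0 => n /n0P; apply: le_trans.
by case: (GP (m, n)) => _ _ /(_ t tab).
Qed.

Lemma ae_simple_limit_addr a b r f :
  ae_simple_limit (r + a) (r + b) f -> ae_simple_limit a b (fun t => f (r + t)).
Proof.
move=> [s [N [sm mN N0 sf]]].
exists (fun n t => s n (r + t)), [set t | N (r + t)]; split.
- by move=> n; exact: finite_measurable_addr.
- exact: borel_addr.
- by rewrite lebesgue_measure_addr.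
- by move=> t tab Nt; apply: sf => //; rewrite !lerD2l.
Qed.

Lemma ae_simple_limit_rnorm_sub a b f x : ae_simple_limit a b f ->
  exists (g : R -> R) (N : set R), [/\
    measurable_fun (`[a, b]%classic : set (measurableTypeR R)) (g : measurableTypeR R -> R),
    borel N, mu N = 0 & forall t, a <= t <= b -> ~ N t -> g t = rnorm (f t - x)].
Proof.
move=> [s [N [sm mN N0 sf]]].
pose g t := rnorm (f t - x) * (\1_(`[a, b]%classic `\` N) t : R).
exists g, N; split => //; last first.
  move=> t tab Nt; rewrite /g indicE mem_set ?mulr1//.
have mA : borel (`[a, b]%classic `\` N).
  by apply: measurableD => //; exact: measurable_itv.
apply: (@measurable_fun_cvg _ (measurableTypeR R) R _ (fun n t => rnorm (s n t - x) *
    (\1_(`[a, b]%classic `\` N) t : R))) => [n|t _].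
  apply: measurable_funM; last exact: measurable_indic.
  apply: (finite_measurable_measurable_fun (s := fun t => rnorm (s n t - x))).
  exact: (finite_measurable_comp (fun p => rnorm (p - x)) (sm n)).
rewrite /g indicE; case: (boolP (t \in _)) => tA /=; last first.
  by rewrite mulr0; under eq_fun do rewrite mulr0; exact: cvg_cst.
rewrite mulr1; under eq_fun do rewrite mulr1.
move: tA; rewrite inE => -[/=]; rewrite in_itv/= => tab Nt.
apply: (@rnorm_cvg R k V nat \oo _ (fun n => s n t - x)).
by apply: cvgB; [exact: sf|exact: cvg_cst].
Qed.

End BoundedBochnerTheory.

(** * Continuous integrands and moving means *)

Section ContinuousIntegrand.
Context (R : realType) (k : scalar_kind) (V : completeNormedModType (scalars R k)).

Definition continuous_on (J : set R) (f : R -> V) : Prop :=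
  forall t, J t -> forall e : R, 0 < e -> exists2 d : R, 0 < d &
    forall s, J s -> `|s - t| < d -> rnorm (f s - f t) <= e.

(** Step functions sample [f] on a grid of mesh [1 / (n + 1)].  The index of the
    grid is shifted by one, so that [0] encodes the complement of [a, b]. *)
Lemma continuous_on_ae_simple_limit (J : set R) (a b : R) (f : R -> V) :
  `[a, b]%classic `<=` J -> continuous_on J f -> ae_simple_limit a b f.
Proof.
move=> abJ fc.
pose grid n t : nat :=
  if t \in `[a, b] then (Num.truncn (n.+1%:R * (t - a))).+1 else 0%N.
pose val n i : V := if i is j.+1 then f (a + j%:R / n.+1%:R) else 0.
have n0 n : 0 < n.+1%:R :> R by [].
have gridP n t : a <= t <= b ->
    let j := Num.truncn (n.+1%:R * (t - a)) in
    j%:R / n.+1%:R <= t - a < j.+1%:R / n.+1%:R.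
  move=> tab /=; rewrite ler_pdivrMr// ltr_pdivlMr// mulrC.
  by apply: truncn_itv; rewrite mulr_ge0// subr_ge0; case/andP: tab.
exists (fun n t => val n (grid n t)), set0; split => //.
- move=> n; apply: (finite_measurable_comp (val n) (s := grid n)); split.
    apply: (@sub_finite_set _ _ `I_((Num.truncn (n.+1%:R * (b - a))).+2)).
      move=> _ [t _ <-] /=; rewrite /grid; case: ifP => //; rewrite in_itv/= => tab.
      by rewrite !ltnS le_truncn// ler_wpM2l// lerD2r; case/andP: tab.
    exact: finite_II.
  case=> [|j].
    rewrite (_ : _ @^-1` _ = ~` `[a, b]%classic).
      by apply: measurableC; exact: measurable_itv.
    by apply/seteqP; split=> t /=; rewrite /grid; case: ifP.
  rewrite (_ : _ @^-1` _ = `[a, b]%classic `&`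
      `[a + j%:R / n.+1%:R, a + j.+1%:R / n.+1%:R[%classic).
    by apply: measurableI; exact: measurable_itv.
  apply/seteqP; split=> t /=; rewrite /grid !in_itv/=.
    case: ifP => // tab [jE]; split => //.
    by have /= := gridP n t tab; rewrite jE -lerBrDl -ltrBlDl.
  move=> [tab]; rewrite tab -lerBrDl -ltrBlDl => jt; congr S.
  by apply: truncn_def; rewrite -ler_pdivrMl// -ltr_pdivlMl// ![_^-1 * _]mulrC.
- move=> t tab _; apply/rnorm_cvgP => e e0.
  have Jt : J t by apply: abJ; rewrite /= in_itv.
  have [d d0 fd] := fc t Jt e e0.
  near=> n; rewrite /grid in_itv/= tab /=.
  have /= := gridP n t tab; set j := Num.truncn _.
  rewrite -[j.+1%:R]natr1 mulrDl mul1r => /andP[].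
  have : 0 <= j%:R / n.+1%:R :> R by rewrite divr_ge0.
  move: (j%:R / n.+1%:R) => q q0 jt tj; case/andP: tab => at_ tb.
  apply: fd; first by apply: abJ; rewrite /= in_itv/=; apply/andP; split; lra.
  have nd : n.+1%:R^-1 < d by near: n; exact: near_infty_natSinv_lt (PosNum d0).
  move: (n.+1%:R^-1) tj nd => w tj nd; rewrite ltr_norml.
  by apply/andP; split; lra.
Unshelve. all: by end_near. Qed.

End ContinuousIntegrand.

Fact moving_mean_key : unit. Proof. exact: tt. Qed.

(** The mean is locked so that comparing two of its values does not unfold the
    choice operator hidden in the integral. *)
Definition moving_mean (R : realType) (k : scalar_kind)
    (V : normedModType (scalars R k)) : R -> (R -> V) -> R -> V :=
  locked_with moving_mean_key (@mean R k V).

Lemma moving_meanE (R : realType) (k : scalar_kind)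
  (V : normedModType (scalars R k)) : @moving_mean R k V = @mean R k V.
Proof. by rewrite /moving_mean unlock. Qed.

Section Mean.
Context (R : realType) (k : scalar_kind) (V : completeNormedModType (scalars R k)).
Local Notation mu := (@lebesgue_measure R).
Local Notation sr := (@scalar_of_real R k).
Implicit Types (h t : R) (f : R -> V) (x : V).

Lemma meanE h t f x : is_bounded_integral t (t + h) f x ->
  moving_mean h f t = sr h^-1 *: x.
Proof.
move=> fx; rewrite moving_meanE /mean; congr (_ *: _); apply: bounded_integralE.
by apply: bounded_integral_addr; rewrite addr0.
Qed.

Lemma rnorm_scale_integral h (x : V) C : 0 < h -> rnorm x <= h * C ->
  rnorm (sr h^-1 *: x) <= C.
Proof.
move=> h0 xC; rewrite rnormZr ger0_norm; last by rewrite invr_ge0 ltW.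
by rewrite ler_pdivrMl.
Qed.

Lemma mean_sub_le h t f x C : 0 < h ->
  is_bounded_integral t (t + h) f x ->
  (forall s, t <= s <= t + h -> rnorm (f s - f t) <= C) ->
  rnorm (moving_mean h f t - f t) <= C.
Proof.
move=> h0 fx fC; rewrite (meanE fx).
have tth : t <= t + h by lra.
have := bounded_integralB fx (bounded_integral_cst (f t) tth).
rewrite (_ : t + h - t = h); last by ring.
move=> /(bounded_integral_le_cst tth)/(_ fC).
rewrite (_ : t + h - t = h); last by ring.
move=> /(rnorm_scale_integral h0).
by rewrite scalerBr scalerA -scalar_of_realM mulVf ?gt_eqF// scalar_of_real1 scale1r.
Qed.

Lemma mean_le h t f x C : 0 < h -> is_bounded_integral t (t + h) f x ->
  (forall s, t <= s <= t + h -> rnorm (f s) <= C) -> rnorm (moving_mean h f t) <= C.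
Proof.
move=> h0 fx fC; rewrite (meanE fx); apply: rnorm_scale_integral => //.
have tth : t <= t + h by lra.
by have := bounded_integral_le_cst tth fx fC; rewrite (_ : t + h - t = h)//; ring.
Qed.

(** The two windows differ by two intervals of length [r]. *)
Lemma mean_lipschitz h t r f x C : 0 < h -> 0 <= r ->
  is_bounded_integral t (t + r + h) f x ->
  (forall s, t <= s <= t + r + h -> rnorm (f s) <= C) ->
  rnorm (moving_mean h f (t + r) - moving_mean h f t) <= 2 * C / h * r.
Proof.
move=> h0 r0 fx fC.
have C0 : 0 <= C by apply: le_trans (fC t _); rewrite ?rnorm_ge0//; lra.
have [|y [ry fy]] := bounded_integral_restrict (_ : t <= t + r) (lexx _) fx; first by lra.
have [|z [rz fz]] := bounded_integral_restrict (lexx _) (_ : t + h <= t + r + h) fx; first by lra.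
rewrite (meanE fy) (meanE fz) -scalerBr; apply: rnorm_scale_integral => //.
rewrite (_ : h * _ = 2 * C * r); last by field; rewrite gt_eqF.
pose G s : R := C * ((\1_(`[t, t + r]%classic) s : R) + (\1_(`[t + h, t + r + h]%classic) s : R)).
have mI (p q : R) : measurable_fun (`[t, t + r + h]%classic : set (measurableTypeR R))
    (\1_(`[p, q]%classic) : measurableTypeR R -> R).
  by apply: measurable_indic; exact: measurable_itv.
have mG : measurable_fun (`[t, t + r + h]%classic : set (measurableTypeR R))
    (G : measurableTypeR R -> R).
  by apply: measurable_funM => //; exact: measurable_funD.
rewrite -lee_fin; apply: le_trans (bounded_integral_le (bounded_integralB ry rz) mG _ _) _.
- by move=> s; rewrite /G mulr_ge0// addr_ge0.
- move=> s sJ; rewrite /G !indicE !mem_setE !in_itv/=.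
  have fs := fC s sJ; case/andP: sJ => ts st.
  have [s1|s1] := leP (t + r) s; have [s2|s2] := leP s (t + h);
    rewrite ?ts ?st ?(ltW s1) ?(ltW s2)/= ?andbF ?andbT/=.
  + by rewrite subrr rnorm0 mulr_ge0// addr_ge0.
  + by rewrite subr0 (le_trans fs)// ler_peMr// lerDr.
  + by rewrite sub0r rnormN (le_trans fs)// ler_peMr// lerDl.
  + by rewrite subrr rnorm0 mulr_ge0// addr_ge0.
have mD : measurable (`[t, t + r + h]%classic : set (measurableTypeR R)).
  exact: measurable_itv.
under eq_integral do rewrite /G EFinM EFinD.
have I0 p q s : (0 <= ((\1_(`[p, q]%classic) s : R)%:E))%E by rewrite lee_fin.
have mE p q : measurable_fun (`[t, t + r + h]%classic : set (measurableTypeR R))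
    (fun s => (\1_(`[p, q]%classic) s : R)%:E).
  exact/measurable_EFinP.
rewrite ge0_integralZl//; last 2 first.
- exact: emeasurable_funD.
- by move=> s _; rewrite adde_ge0.
rewrite ge0_integralD//.
have itv p q : p <= q -> (\int[mu]_(s in `[t, (t + r + h)%R])
    (\1_(`[p, q]%classic) s : R)%:E <= (q - p)%:E)%E.
  move=> pq; rewrite integral_indic//.
  apply: (@le_trans _ _ (mu `[p, q]%classic)).
    by apply: le_measure; rewrite ?inE//; apply: measurableI.
  rewrite lebesgue_measure_itv/= lte_fin; case: ifPn => //.
  by rewrite lee_fin subr_ge0.
apply: (@le_trans _ _ (C%:E * (r%:E + r%:E))%E).
  apply: lee_wpmul2l; first by rewrite lee_fin.
  apply: leeD; first by apply: le_trans (itv _ _ _) _; rewrite ?lee_fin; lra.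
  by apply: le_trans (itv _ _ _) _; rewrite ?lee_fin; lra.
by rewrite -EFinD -EFinM lee_fin; lra.
Qed.

End Mean.

(** * Uniform boundedness of the differences *)

Section DifferenceBound.
Context (R : realType) (k : scalar_kind) (V : completeNormedModType (scalars R k)).
Local Notation mu := (@lebesgue_measure R).
Local Notation borel A := (measurable (A : set (measurableTypeR R))).
Context (J : set R) (Jup : forall t s, J t -> t <= s -> J s).
Context (f : R -> V).
Hypothesis f_limit : forall a b, J a -> a <= b -> ae_simple_limit a b f.

(** [f] is only almost everywhere a limit of simple functions, so that large
    increments form a Borel set [A] only up to a null set [N]. *)
Definition large_increments (h c t : R) (A N : set R) : Prop :=
  [/\ borel A, borel N, mu N = 0,
    forall s, 0 <= s <= h -> ~ A s -> ~ N s -> rnorm (f (t + s) - f t) <= c &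
    forall s, 0 <= s <= h -> A s -> c < rnorm (f (t + s) - f t)].

Lemma large_increments_exist (h c t : R) : 0 <= h -> J t ->
  exists A N, large_increments h c t A N.
Proof.
move=> h0 Jt; have tth : t <= t + h by lra.
have := @ae_simple_limit_addr R k V 0 h t f.
rewrite addr0 => /(_ (f_limit Jt tth)) /(ae_simple_limit_rnorm_sub (f t)).
move=> [g [N [mg mN N0 gf]]].
exists ((`[0, h]%classic `&` g @^-1` `]c, +oo[%classic) `\` N), N; split => //.
- apply: measurableD => //; apply: mg; exact: measurable_itv.
- move=> s sh sA Ns; rewrite -gf// leNgt; apply/negP => cg; apply: sA.
  by split => //; split => /=; rewrite in_itv/= ?andbT.
- by move=> s sh [[_ /=]]; rewrite in_itv/= andbT => cg Ns; rewrite -gf.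
Qed.

(** Steinhaus's argument: if the difference with increment [b_ n] at [t_ n]
    exceeds [n], then for large [n] most [s] have differences at most [n / 3] both
    for [s] at [t_ n] and for [s - b_ n] at [t_ n + b_ n], and any such [s] gives a
    contradiction. *)
Lemma uniform_difference_bound (h : R) : 0 < h ->
  (forall s, 0 < s -> exists M, forall t, J t -> rnorm (f (t + s) - f t) <= M) ->
  exists C, forall t s, J t -> 0 <= s <= h -> rnorm (f (t + s) - f t) <= C.
Proof.
move=> h0 bnd; apply: contrapT => unbd.
have /choice[tb tbP] : forall n : nat, exists p : R * R,
    [/\ J p.1, 0 <= p.2 <= h & n%:R < rnorm (f (p.1 + p.2) - f p.1)].
  move=> n; apply: contrapT => H; apply: unbd; exists n%:R => t s Jt sh.
  by rewrite leNgt; apply/negP => nf; apply: H; exists (t, s).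
have h30 : 0 <= 3 * h by lra.
have Jt n : J (tb n).1 by case: (tbP n).
have Jtb n : J ((tb n).1 + (tb n).2).
  by apply: Jup (Jt n) _; case: (tbP n) => _ /andP[b0 _] _; lra.
have large n t : J t ->
    exists AN : set R * set R, large_increments (3 * h) (n%:R / 3) t AN.1 AN.2.
  by move=> /(large_increments_exist (n%:R / 3) h30)[A [N AN]]; exists (A, N).
have /choice[AN ANP] := fun n => large n _ (Jt n).
have /choice[BM BMP] := fun n => large n _ (Jtb n).
pose D := `[0, 3 * h]%classic : set (measurableTypeR R).
have mD : measurable D by exact: measurable_itv.
have mA n : borel (AN n).1 by case: (ANP n).
have mB n : borel (BM n).1 by case: (BMP n).
pose G (_ n : nat) s : R := (\1_((AN n).1) s : R) + (\1_((BM n).1) s : R).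
have small t A N : (forall n, J (t n)) ->
    (forall n, large_increments (3 * h) (n%:R / 3) (t n) (A n) (N n)) ->
    forall s, 0 <= s <= 3 * h ->
    exists n0, forall n, (n0 <= n)%N -> (\1_(A n) s : R) = 0.
  move=> Jt' ANP' s sh.
  have [M fM] : exists M, forall t, J t -> rnorm (f (t + s) - f t) <= M.
    have [->|s0] := eqVneq s 0.
      by exists 0 => u _; rewrite addr0 subrr rnorm0.
    by apply: bnd; rewrite lt_neqAle eq_sym s0; case/andP: sh.
  exists (Num.truncn (3 * `|M|)).+1 => n Mn; rewrite indicE memNset//.
  case: (ANP' n) => _ _ _ _ A_lt /(A_lt s sh); apply/negP; rewrite -leNgt.
  rewrite (le_trans (fM _ (Jt' n)))// ler_pdivlMr// mulrC.
  rewrite (@le_trans _ _ (3 * `|M|))//; first by rewrite ler_pM2l// ler_norm.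
  rewrite ltW// (lt_le_trans (truncnS_gt _))// ler_nat.
  exact: Mn.
have [m [n Gn]] : exists m n, (\int[mu]_(s in D) (G m n s)%:E < h%:E)%E.
  apply: (@iterated_bounded_convergence R 0 (3 * h) 2) => //.
  - move=> m n; apply: measurable_funD; apply: measurable_indic; [exact: mA|exact: mB].
  - move=> m n s; rewrite /G !indicE; apply/andP; split; first by rewrite addr_ge0.
    by case: (s \in _); case: (s \in _) => /=; lra.
  - move=> s; rewrite in_itv/= => sh e e0; exists 0%N => m _.
    have [n1 n1P] := small _ _ _ Jt ANP s sh.
    have [n2 n2P] := small _ _ _ Jtb BMP s sh.
    exists (maxn n1 n2) => n; rewrite geq_max => /andP[/n1P n1n /n2P n2n].
    by rewrite /G n1n n2n addr0 ltW.
move: Gn; rewrite /G; under eq_integral do rewrite EFinD.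
rewrite ge0_integralD//; last 2 first.
- by apply/measurable_EFinP; exact: measurable_indic.
- by apply/measurable_EFinP; exact: measurable_indic.
rewrite !integral_indic// => ABh.
have [Jn /andP[b0 bh] nf] := tbP n.
case: (ANP n) => mA' mN N0 ANs _; case: (BMP n) => mB' mM M0 BMs _.
set A := (AN n).1 in mA' ANs ABh; set N := (AN n).2 in mN N0 ANs.
set B := (BM n).1 in mB' BMs ABh; set M := (BM n).2 in mM M0 BMs.
set t := (tb n).1 in Jn nf BMs ANs; set b := (tb n).2 in b0 bh nf BMs.
pose bad := ((A `&` D) `|` N) `|` [set s | ((B `&` D) `|` M) (- b + s)].
have [s [bs sh nbad]] : exists s, [/\ b <= s, s <= 3 * h & ~ bad s].
  apply: contrapT => H.
  have sub : `[b, 3 * h]%classic `<=` bad.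
    move=> s /=; rewrite in_itv/= => /andP[bs sh]; apply: contrapT => nb.
    by apply: H; exists s.
  have mBD : borel (B `&` D) by exact: measurableI.
  have mAD : borel (A `&` D) by exact: measurableI.
  have mbad2 : borel [set s | ((B `&` D) `|` M) (- b + s)].
    by apply: borel_addr; exact: measurableU.
  have : (mu `[b, (3 * h)%R]%classic <= mu (A `&` D) + mu (B `&` D))%E.
    apply: (@le_trans _ _ (mu bad)).
      apply: le_measure => //; rewrite inE; first exact: measurable_itv.
      by apply: measurableU => //; exact: measurableU.
    apply: le_trans (measureU2 _ _ _) _ => //; first exact: measurableU.
    have AN0 : mu ((A `&` D) `|` N) = mu (A `&` D) by exact: measureU0.
    have BM0 : mu ((B `&` D) `|` M) = mu (B `&` D) by exact: measureU0.
    have BMr := lebesgue_measure_addr (- b) (measurableU _ _ mBD mM).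
    by apply: leeD; [rewrite -AN0|rewrite -BM0 -BMr].
  rewrite leNgt => /negP; apply; apply: lt_le_trans ABh _.
  rewrite lebesgue_measure_itv/= lte_fin ifT; last by lra.
  by rewrite -EFinB lee_fin; lra.
have nA : ~ A s by move=> As; apply: nbad; left; left; split => //; rewrite /D /= in_itv/=; lra.
have nN : ~ N s by move=> Ns; apply: nbad; left; right.
have nB : ~ B (- b + s).
  by move=> Bs; apply: nbad; right; left; split => //; rewrite /D /= in_itv/=; lra.
have nM : ~ M (- b + s) by move=> Ms; apply: nbad; right; right.
have s1 : 0 <= s <= 3 * h by lra.
have s2 : 0 <= - b + s <= 3 * h by lra.
have f1 := ANs _ s1 nA nN; have f2 := BMs _ s2 nB nM.
move: nf; apply/negP; rewrite -leNgt.
have -> : f (t + b) - f t = (f (t + s) - f t) - (f (t + b + (- b + s)) - f (t + b)).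
  have -> : t + b + (- b + s) = t + s by ring.
  by rewrite opprB [RHS]addrC addrA subrK.
apply: le_trans (rnormB _ _) _; apply: le_trans (lerD f1 f2) _.
by have : 0 <= n%:R :> R by []; lra.
Qed.

End DifferenceBound.

(** * Bounded uniformly continuous functions *)

Section UniformlyContinuous.
Context (R : realType) (k : scalar_kind).
Local Notation K := (scalars R k).
Local Notation sr := (@scalar_of_real R k).

Section Definitions.
Context (V : normedModType K).
Implicit Types (J : set R) (u v : R -> V).

Definition bounded_on J u := exists M : R, forall t, J t -> rnorm (u t) <= M.

Definition uniformly_continuous_on J u := forall e : R, 0 < e ->
  exists2 d : R, 0 < d & forall s t, J s -> J t -> `|s - t| < d ->
    rnorm (u s - u t) <= e.

Definition buc_on J u := bounded_on J u /\ uniformly_continuous_on J u.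

Lemma BUCP J u : BUC V J u <-> buc_on J u.
Proof.
rewrite /BUC /= rnorm_boundedP; split=> [[uc ub]|[ub uc]]; split => //.
  move=> e e0; have /uc : entourage [set xy : V * V | rnorm (xy.1 - xy.2) < e].
    by apply/entourage_rnormP; exists e.
  move=> [E entE EJ]; have : entourage (E : set (R * R)) by [].
  rewrite -entourage_ballE => -[d /= d0 dE]; exists d => // s t Js Jt st.
  apply: ltW; apply: (EJ (s, t)) => /=; right; split => //; split => //.
  exact: dE.
move=> E /entourage_rnormP[e e0 eE].
have [|d d0 ud] := uc (e / 2); first by rewrite divr_gt0.
exists [set xy : R * R | `|xy.1 - xy.2| < d].
  by rewrite -entourage_ballE; exists d.
move=> [s t] /= [->|[Js [Jt st]]]; apply: eE.
  by rewrite subrr rnorm0.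
by apply: le_lt_trans (ud s t Js Jt st) _; lra.
Qed.

Lemma eq_buc_on J u v : (forall t, J t -> u t = v t) -> buc_on J u -> buc_on J v.
Proof.
move=> uv [[M uM] uc]; split; first by exists M => t Jt; rewrite -uv// uM.
move=> e /uc[d d0 ud]; exists d => // s t Js Jt st.
by rewrite -!uv// ud.
Qed.

Lemma buc_on_sub J J' u : J' `<=` J -> buc_on J u -> buc_on J' u.
Proof.
move=> J'J [[M uM] uc]; split; first by exists M => t /J'J; exact: uM.
move=> e /uc[d d0 ud]; exists d => // s t /J'J Js /J'J Jt; exact: ud.
Qed.

Lemma buc_onD J u v : buc_on J u -> buc_on J v -> buc_on J (fun t => u t + v t).
Proof.
move=> [[M uM] uc] [[N vN] vc]; split.
  exists (M + N) => t Jt; apply: le_trans (rnormD _ _) _.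
  by rewrite lerD ?uM ?vN.
move=> e e0; have e20 : 0 < e / 2 by lra.
have [d d0 ud] := uc _ e20; have [d' d'0 vd] := vc _ e20.
exists (Num.min d d'); first by rewrite lt_min d0 d'0.
move=> s t Js Jt; rewrite lt_min => /andP[sd sd'].
rewrite opprD addrACA [e]splitr; apply: le_trans (rnormD _ _) _.
by rewrite lerD ?ud ?vd.
Qed.

Lemma buc_onN J u : buc_on J u -> buc_on J (fun t => - u t).
Proof.
move=> [[M uM] uc]; split; first by exists M => t Jt; rewrite rnormN uM.
move=> e /uc[d d0 ud]; exists d => // s t Js Jt st.
by rewrite -opprD rnormN ud.
Qed.

Lemma buc_onB J u v : buc_on J u -> buc_on J v -> buc_on J (fun t => u t - v t).
Proof. by move=> bu /buc_onN; exact: buc_onD. Qed.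

Lemma buc_onZ J (c : R -> K^o) u :
  (exists M : R, forall t, J t -> rnorm (c t) <= M) ->
  (forall e : R, 0 < e -> exists2 d : R, 0 < d &
    forall s t, J s -> J t -> `|s - t| < d -> rnorm (c s - c t) <= e) ->
  buc_on J u -> buc_on J (fun t => c t *: u t).
Proof.
move=> [N cN] cc [[M uM] uc]; split.
  exists (N * M) => t Jt; rewrite rnormZ ler_pM ?rnorm_ge0 ?uM//.
  exact: cN.
move=> e e0.
have P0 (x : R) : 0 < `|x| + 1 by rewrite ltr_wpDl.
have [|d d0 ud] := uc (e / 2 / (`|N| + 1)); first by rewrite !divr_gt0.
have [|d' d'0 cd] := cc (e / 2 / (`|M| + 1)); first by rewrite !divr_gt0.
exists (Num.min d d'); first by rewrite lt_min d0 d'0.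
move=> s t Js Jt; rewrite lt_min => /andP[sd sd'].
have -> : c s *: u s - c t *: u t = (c s - c t) *: u s + c t *: (u s - u t).
  by rewrite scalerBl scalerBr addrA subrK.
rewrite [e]splitr; apply: le_trans (rnormD _ _) _; rewrite !rnormZ; apply: lerD.
  rewrite -[leRHS](@divfK _ (`|M| + 1)) ?gt_eqF// ler_pM ?rnorm_ge0//; first exact: cd.
  by rewrite (le_trans (uM _ Js))// (le_trans (ler_norm _))// lerDl.
rewrite -[leRHS](@divfK _ (`|N| + 1)) ?gt_eqF// mulrC ler_pM ?rnorm_ge0//; first exact: ud.
by rewrite (le_trans (cN _ Jt))// (le_trans (ler_norm _))// lerDl.
Qed.

(** Multiplication by a Lipschitz function that vanishes off [J] extends a
    function of [J] to the whole line. *)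
Lemma buc_on_extend J (eta : R -> R) u :
  (forall t, 0 <= eta t <= 1) -> (forall s t, `|eta s - eta t| <= `|s - t|) ->
  (forall t, ~ J t -> eta t = 0) ->
  buc_on J u -> buc_on setT (fun t => sr (eta t) *: u t).
Proof.
move=> eta01 etaL etaJ [[M uM] uc].
have etaN t : `|eta t| = eta t by rewrite ger0_norm//; case/andP: (eta01 t).
have bd t : rnorm (sr (eta t) *: u t) <= eta t * `|M|.
  rewrite rnormZr etaN; have [Jt|/etaJ->] := pselect (J t); last by rewrite !mul0r.
  rewrite ler_wpM2l//; first by case/andP: (eta01 t).
  by rewrite (le_trans (uM _ Jt))// ler_norm.
split.
  exists `|M| => t _; apply: le_trans (bd t) _; rewrite ler_piMl//.
  by case/andP: (eta01 t).
move=> e e0; have P0 : 0 < `|M| + 1 by rewrite ltr_wpDl.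
have e20 : 0 < e / 2 by lra.
have [d d0 ud] := uc _ e20.
exists (Num.min d (e / 2 / (`|M| + 1))).
  by rewrite lt_min d0/= !divr_gt0.
move=> s t _ _; rewrite lt_min => /andP[sd se].
have ele x : 0 <= x -> x <= `|s - t| -> x * `|M| <= e / 2.
  move=> x0 xle; rewrite -[leRHS](@divfK _ (`|M| + 1)) ?gt_eqF// ler_pM//.
    by rewrite (le_trans xle)// ltW.
  by rewrite lerDl.
have one s' t' : `|s' - t'| = `|s - t| -> ~ J t' ->
    rnorm (sr (eta s') *: u s' - sr (eta t') *: u t') <= e.
  move=> st Jt'; rewrite (etaJ _ Jt') scalar_of_real0 scale0r subr0.
  apply: le_trans (bd _) _; apply: (@le_trans _ _ (e / 2)); last by lra.
  apply: ele; first by case/andP: (eta01 s').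
  by rewrite -st (le_trans _ (etaL _ _))// (etaJ _ Jt') subr0 ler_norm.
have [Jt|] := pselect (J t); last exact: one.
have [Js|Js] := pselect (J s); last first.
  by rewrite rnorm_distC; apply: one => //; rewrite distrC.
have -> : sr (eta s) *: u s - sr (eta t) *: u t =
    sr (eta s - eta t) *: u s + sr (eta t) *: (u s - u t).
  by rewrite scalar_of_realB scalerBl scalerBr addrA subrK.
rewrite [e]splitr; apply: le_trans (rnormD _ _) _; rewrite !rnormZr; apply: lerD.
  apply: le_trans (ele _ _ (etaL s t)) => //; rewrite ler_wpM2l//.
  by rewrite (le_trans (uM _ Js))// ler_norm.
rewrite etaN (le_trans _ (ud s t Js Jt sd))// ler_piMl ?rnorm_ge0//.
by case/andP: (eta01 t).
Qed.

(** The margin [1] ensures that two points at distance less than [1] either both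
    lie in the enlarged interval or both lie where [u] vanishes. *)
Lemma buc_on_compact_support J u (T : R) :
  (forall t, J t -> T <= `|t| -> u t = 0) ->
  buc_on (J `&` [set t | `|t| <= T + 1]) u -> buc_on J u.
Proof.
move=> u0 [[M uM] uc]; split.
  exists `|M| => t Jt; have [Tt|tT] := leP T `|t|.
    by rewrite u0// rnorm0.
  by apply: le_trans (uM t _) (ler_norm _); split => //=; lra.
move=> e e0; have [d d0 ud] := uc e e0; exists (Num.min d 1).
  by rewrite lt_min d0 ltr01.
move=> s t Js Jt; rewrite lt_min => /andP[sd s1].
have := lerB_dist s t; have := lerB_dist t s; rewrite (distrC t s) => ts st.
have [Ts|sT] := leP `|s| (T + 1); last first.
  by rewrite !u0 ?subrr ?rnorm0 ?(ltW e0)//; lra.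
have [Tt|tT] := leP `|t| (T + 1); last first.
  by rewrite !u0 ?subrr ?rnorm0 ?(ltW e0)//; lra.
exact: ud.
Qed.

End Definitions.

(** The Heine-Cantor theorem. *)
Lemma continuous_on_compact_uniform (V : normedModType K) (g : R -> V) (a b : R) :
  (forall t, forall e : R, 0 < e -> exists2 d : R, 0 < d &
    forall s, `|s - t| < d -> rnorm (g s - g t) <= e) ->
  uniformly_continuous_on `[a, b]%classic g.
Proof.
move=> gc e e0.
have [d d0 gd] : exists2 d : R, 0 < d & forall t, t \in `[a, b] ->
    forall s, `|s - t| < d -> rnorm (g s - g t) <= e.
  have := @segment_compact R a b => /compact_near_coveringP.
  move=> /(_ R (0 : R)^'+ (fun d t => forall s, `|s - t| < d -> rnorm (g s - g t) <= e)).
  move=> /(_ _)[].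
    move=> t _ /=.
    have [|d d0 gd] := gc t (e / 2); first by lra.
    have d20 : 0 < d / 2 by lra.
    near=> x d' => s /= sx.
    have xt : `|t - x| < d / 2.
      by near: x; apply: (@cvgr_dist_lt _ R^o _ _ _ id t) => //; exact: cvg_id.
    have d'd : d' < d / 2 by near: d'; exact: nbhs_right_lt.
    rewrite [e]splitr (_ : g s - g x = (g s - g t) - (g x - g t)).
      apply: le_trans (rnormB _ _) _; apply: lerD; apply: gd.
        by rewrite -(subrKA x) (le_lt_trans (ler_normD _ _))// (distrC x); lra.
      by rewrite distrC; lra.
    by rewrite opprB addrA subrK.
  move=> d /= d0 H; exists (d / 2); first by rewrite divr_gt0.
  move=> t tab; apply: (H (d / 2)) => //.
  - by rewrite /= sub0r normrN gtr0_norm; lra.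
  - by lra.
by exists d => // s t _ tab; exact: gd.
Unshelve. all: by end_near. Qed.

End UniformlyContinuous.

(** * A Lipschitz cutoff *)

Section Clamp.
Context (R : realType).
Implicit Types x y : R.

Definition clamp01 x : R := Num.min 1 (Num.max 0 x).

Lemma clamp01_itv x : 0 <= clamp01 x <= 1.
Proof. by rewrite /clamp01 ge_min lexx/= andbT le_min ler01/= le_max lexx. Qed.

Lemma clamp01_lipschitz x y : `|clamp01 x - clamp01 y| <= `|x - y|.
Proof.
have := ler_norm (x - y); have := ler_norm (y - x); rewrite (distrC y x).
have := normr_ge0 (x - y).
rewrite /clamp01 ler_norml => ? ? ?.
rewrite /Num.max; case: ltP => ?; case: ltP => ?;
  rewrite /Num.min; case: ltP => ?; case: ltP => ?; apply/andP; split; lra.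
Qed.

Lemma clamp01_le0 x : x <= 0 -> clamp01 x = 0.
Proof. by move=> x0; rewrite /clamp01 (max_idPl x0) (min_idPr ler01). Qed.

Lemma clamp01_ge1 x : 1 <= x -> clamp01 x = 1.
Proof.
by move=> x1; rewrite /clamp01 (max_idPr (le_trans ler01 x1)) (min_idPl x1).
Qed.

End Clamp.

(** * The closedness of the vector sum *)

Section Closedness.
Context (R : realType) (k : scalar_kind) (V : completeNormedModType (scalars R k)).
Local Notation K := (scalars R k).
Local Notation sr := (@scalar_of_real R k).

Lemma geometric_buc_on_limit (J : set R) (S : nat -> R -> V) (C : R) :
  (forall n, buc_on J (S n)) ->
  (forall n t, J t -> rnorm (S n.+1 t - S n t) <= C / 2 ^+ n) ->
  exists2 A, buc_on J A & forall t, J t -> S n t @[n --> \oo] --> A t.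
Proof.
move=> Sbuc dS.
have pow0 n : 0 < 2 ^+ n :> R by rewrite exprn_gt0.
have tail n p t : J t -> rnorm (S (n + p)%N t - S n t) <= 2 * C / 2 ^+ n - 2 * C / 2 ^+ (n + p).
  move=> Jt; elim: p => [|p IHp]; first by rewrite addn0 !subrr rnorm0.
  rewrite addnS -(subrKA (S (n + p)%N t)); apply: le_trans (rnormD _ _) _.
  apply: le_trans (lerD (dS _ _ Jt) IHp) _; rewrite exprS invfM.
  by move: (2 ^+ (n + p)) (2 ^+ n) => x y; lra.
have [J0|/nonemptyPn J0] := pselect (J !=set0); last first.
  exists (fun=> 0); last by move=> t; rewrite J0.
  by split; [exists 0 => t; rewrite J0|move=> e e0; exists 1 => // s t; rewrite J0].
have C0 : 0 <= C.
  case: J0 => t Jt; have := dS 0%N t Jt; rewrite expr0 divr1.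
  exact: le_trans (rnorm_ge0 _).
have {}tail n m t : J t -> (n <= m)%N -> rnorm (S m t - S n t) <= 2 * C / 2 ^+ n.
  move=> Jt /subnKC <-; apply: le_trans (tail _ _ _ Jt) _.
  by rewrite lerBlDr lerDl divr_ge0 ?mulr_ge0// ltW.
have small (e : R) : 0 < e -> exists n, 2 * C / 2 ^+ n <= e.
  move=> e0; exists (Num.truncn (2 * C / e)).+1.
  rewrite ler_pdivrMr// -ler_pdivrMl// [e^-1 * _]mulrC.
  apply: ltW; apply: lt_le_trans (truncnS_gt _) _.
  by rewrite -natrX ler_nat ltnW// ltn_expl.
have lim t : J t -> exists x : V, S n t @[n --> \oo] --> x.
  move=> Jt; apply: rnorm_cauchy_cvg => e e0.
  have [|N NP] := small (e / 2); first by lra.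
  exists N => m n Nm Nn; rewrite (_ : S m t - S n t = (S m t - S N t) - (S n t - S N t)).
    apply: le_trans (rnormB _ _) _.
    by rewrite [e]splitr lerD// (le_trans (tail _ _ _ _ _) NP).
  by rewrite opprB addrA subrK.
have /choice[A SA] : forall t, exists x : V, J t -> S n t @[n --> \oo] --> x.
  move=> t; have [/lim[x Sx]|nJ] := pselect (J t); first by exists x.
  by exists 0.
have SAe n t : J t -> rnorm (A t - S n t) <= 2 * C / 2 ^+ n.
  move=> Jt; have /rnorm_cvg h : S m t - S n t @[m --> \oo] --> A t - S n t.
    by apply: cvgB; [exact: SA|exact: cvg_cst].
  by apply: (cvgr_to_le h); exists n => // m /= nm; exact: tail.
exists A => //; split.
  have [[M SM] _] := Sbuc 0%N; exists (2 * C / 2 ^+ 0 + M) => t Jt.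
  rewrite -(subrK (S 0%N t) (A t)); apply: le_trans (rnormD _ _) _.
  by rewrite lerD ?SAe ?SM.
move=> e e0; have e30 : 0 < e / 3 by lra.
have [n nP] := small _ e30.
have [_ /(_ _ e30)[d d0 Sd]] := Sbuc n.
exists d => // s t Js Jt st.
rewrite (_ : A s - A t = (A s - S n s) + (S n s - S n t) - (A t - S n t)).
  apply: le_trans (rnormB _ _) _.
  apply: le_trans (lerD (rnormD _ _) (lexx _)) _.
  have := SAe n s Js; have := SAe n t Jt; have := Sd s t Js Jt st; lra.
by rewrite subrKA opprB subrKA.
Qed.

Context (gamma : R -> K^o) (c0 C0 : R).
Hypotheses (c0_gt0 : 0 < c0) (gamma_ge : forall t, c0 <= rnorm (gamma t))
  (gamma_le : forall t, rnorm (gamma t) <= C0)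
  (gamma_continuous : forall t, forall e : R, 0 < e -> exists2 d : R, 0 < d &
    forall s, `|s - t| < d -> rnorm (gamma s - gamma t) <= e).

Lemma gamma_neq0 t : gamma t != 0.
Proof.
apply/eqP => gt0; have := gamma_ge t; rewrite gt0 rnorm0.
by rewrite leNgt c0_gt0.
Qed.

Lemma gammaVK (W : normedModType K) t (x : W) : gamma t *: ((gamma t)^-1 *: x) = x.
Proof. by rewrite scalerA divff ?scale1r// gamma_neq0. Qed.

Lemma rnorm_gammaV_scale (W : normedModType K) t (x : W) :
  rnorm ((gamma t)^-1 *: x) <= c0^-1 * rnorm x.
Proof.
rewrite -[X in _ * rnorm X](gammaVK t) [in leRHS]rnormZ mulrA ler_peMl ?rnorm_ge0//.
by rewrite mulrC ler_pdivlMr// mul1r.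
Qed.

Lemma gammaV_sub s t : rnorm ((gamma s)^-1 - (gamma t)^-1 : K^o) <=
  c0^-1 * (c0^-1 * rnorm (gamma s - gamma t)).
Proof.
have -> : ((gamma s)^-1 - (gamma t)^-1 : K^o) =
    - ((gamma s)^-1 *: ((gamma t)^-1 *: (gamma s - gamma t)) : K^o).
  rewrite -scalerN -scalerN opprB /GRing.scale/= mulrBr mulVf ?gamma_neq0//.
  rewrite mulrBr mulr1 mulrCA mulVf ?gamma_neq0// mulr1.
  by [].
rewrite rnormN; apply: le_trans (rnorm_gammaV_scale _ _) _.
by rewrite ler_wpM2l ?invr_ge0 ?(ltW c0_gt0)// rnorm_gammaV_scale.
Qed.

Lemma gammaV_uniformly_continuous (a b e : R) : 0 < e ->
  exists2 d : R, 0 < d & forall s t, a <= s <= b -> a <= t <= b ->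
    `|s - t| < d -> rnorm ((gamma s)^-1 - (gamma t)^-1 : K^o) <= e.
Proof.
move=> e0.
have [|d d0 gd] := continuous_on_compact_uniform (V := K^o) a b gamma_continuous (e := c0 * (c0 * e)).
  by rewrite !mulr_gt0.
exists d => // s t sab tab st; apply: le_trans (gammaV_sub _ _) _.
by rewrite -!ler_pdivlMl ?invr_gt0// !invrK gd//= in_itv.
Qed.

Hypothesis gamma_limsup : forall u v : R -> V, buc_on setT u -> buc_on setT v ->
  forall r : R, (forall t, rnorm (u t + gamma t *: v t) <= r) ->
  forall e : R, 0 < e -> exists T : R, forall t, T <= `|t| -> rnorm (u t) <= r + e.

Context (J : set R) (eta : R -> R) (T0 : R).
Hypotheses (eta01 : forall t, 0 <= eta t <= 1)
  (eta_lipschitz : forall s t, `|eta s - eta t| <= `|s - t|)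
  (eta_out : forall t, ~ J t -> eta t = 0)
  (eta_far : forall t, J t -> T0 <= `|t| -> eta t = 1).

(** Multiplication by [eta] extends both summands to the line without increasing
    the norm of the sum and without changing them far out in [J]. *)
Lemma rnorm_le_at_infinity (u v : R -> V) (r e : R) : 0 <= r -> 0 < e ->
  buc_on J u -> buc_on J v ->
  (forall t, J t -> rnorm (u t + gamma t *: v t) <= r) ->
  exists T : R, forall t, J t -> T <= `|t| -> rnorm (u t) <= r + e.
Proof.
move=> r0 e0 uJ vJ uv.
have [|T TP] := gamma_limsup (buc_on_extend eta01 eta_lipschitz eta_out uJ)
  (buc_on_extend eta01 eta_lipschitz eta_out vJ) (r := r) _ e0.
  move=> t; rewrite scalerA mulrC -scalerA -scalerDr rnormZr ger0_norm; last by case/andP: (eta01 t).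
  have [Jt|/eta_out->] := pselect (J t); last by rewrite mul0r.
  apply: le_trans (uv t Jt); rewrite ler_piMl ?rnorm_ge0//.
  by case/andP: (eta01 t).
exists (Num.max T T0) => t Jt; rewrite ge_max => /andP[Tt T0t].
by have := TP t Tt; rewrite eta_far// scalar_of_real1 scale1r.
Qed.

(** A sum of norm at most [r] has summands of comparable norms: at infinity this
    is the hypothesis on [gamma], and the part of [u] over a compact interval may
    be moved to the other summand, since dividing it by [gamma] keeps it
    uniformly continuous. *)
Lemma controlled_decomposition (u v : R -> V) (r : R) : 0 < r -> buc_on J u -> buc_on J v ->
  (forall t, J t -> rnorm (u t + gamma t *: v t) <= r) ->
  exists u' v' : R -> V, [/\ buc_on J u', buc_on J v',
    forall t, J t -> u' t + gamma t *: v' t = u t + gamma t *: v t,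
    forall t, J t -> rnorm (u' t) <= 2 * r &
    forall t, J t -> rnorm (v' t) <= c0^-1 * (3 * r)].
Proof.
move=> r0 uJ vJ uv.
have [T TP] := rnorm_le_at_infinity (ltW r0) r0 uJ vJ uv.
pose chi (t : R) := clamp01 (`|t| - T).
have chiL s t : `|chi s - chi t| <= `|s - t|.
  apply: le_trans (clamp01_lipschitz _ _) _.
  by rewrite opprB addrA subrK ler_dist_dist.
have chi01 t : 0 <= chi t <= 1 by exact: clamp01_itv.
have bucc (c : R -> R) (I : set R) (w : R -> V) : (forall t, 0 <= c t <= 1) ->
    (forall s t, `|c s - c t| <= `|s - t|) -> buc_on I w ->
    buc_on I (fun t => sr (c t) *: w t).
  move=> c01 cL; apply: (@buc_onZ _ _ V I (fun t => sr (c t) : K^o)).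
    exists 1 => t _; rewrite /rnorm norm_scalar_of_real scalar_of_realK.
    by rewrite ger0_norm; case/andP: (c01 t).
  move=> e e0; exists e => // s t _ _ st.
  rewrite -scalar_of_realB /rnorm norm_scalar_of_real scalar_of_realK.
  by rewrite (le_trans (cL _ _))// ltW.
have u'J : buc_on J (fun t => sr (chi t) *: u t) by exact: bucc.
pose w t := (gamma t)^-1 *: (sr (1 - chi t) *: u t).
have wJ : buc_on J w.
  apply: (@buc_on_compact_support _ _ _ _ _ (T + 1)) => [t Jt Tt|].
    rewrite /w /chi clamp01_ge1 ?subrr ?scalar_of_real0 ?scale0r ?scaler0//.
    by rewrite lerBrDr addrC.
  apply: (@buc_onZ _ _ V _ (fun t => (gamma t)^-1 : K^o)).
  - exists (c0^-1 * rnorm (1 : K^o)) => t _.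
    by rewrite -[X in rnorm X]mulr1; exact: (@rnorm_gammaV_scale K^o).
  - move=> e e0; have [d d0 gd] := gammaV_uniformly_continuous (- (T + 1 + 1)) (T + 1 + 1) e0.
    by exists d => // s t [_ /= sT] [_ /= tT]; apply: gd; rewrite -ler_norml.
  - apply: bucc; last by apply: buc_on_sub uJ => t [].
      by move=> t; have := chi01 t; lra.
    move=> s t; have -> : 1 - chi s - (1 - chi t) = chi t - chi s by ring.
    by rewrite distrC; exact: chiL.
have eqw t : sr (chi t) *: u t + gamma t *: (v t + w t) = u t + gamma t *: v t.
  rewrite scalerDr gammaVK scalar_of_realB scalar_of_real1 scalerBl scale1r.
  by rewrite addrCA subrKC addrC.
have u'r t : J t -> rnorm (sr (chi t) *: u t) <= 2 * r.
  move=> Jt; have [Tt|tT] := leP T `|t|.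
    rewrite rnormZr ger0_norm; last by case/andP: (chi01 t).
    apply: (@le_trans _ _ (rnorm (u t))).
      by rewrite ler_piMl ?rnorm_ge0//; case/andP: (chi01 t).
    by have := TP t Jt Tt; lra.
  by rewrite /chi clamp01_le0 ?scalar_of_real0 ?scale0r ?rnorm0; lra.
exists (fun t => sr (chi t) *: u t), (fun t => v t + w t); split => //.
  exact: buc_onD.
move=> t Jt; rewrite -[X in rnorm X](scalerK (gamma_neq0 t)).
apply: le_trans (rnorm_gammaV_scale _ _) _; rewrite ler_wpM2l ?invr_ge0 ?(ltW c0_gt0)//.
rewrite -[X in rnorm X](addKr (sr (chi t) *: u t)) eqw addrC.
apply: le_trans (rnormB _ _) _.
by have := u'r t Jt; have := uv t Jt; lra.
Qed.

(** Consecutive approximations differ by small elements of the sum.  Decomposing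
    each of these differences with control makes the series of the first and of
    the second summands converge uniformly. *)
Lemma uniform_limit_buc_on_sum (w : R -> V) :
  (forall e : R, 0 < e -> exists u v : R -> V, [/\ buc_on J u, buc_on J v &
    forall t, J t -> rnorm (w t - (u t + gamma t *: v t)) <= e]) ->
  exists u v : R -> V, [/\ buc_on J u, buc_on J v &
    forall t, J t -> w t = u t + gamma t *: v t].
Proof.
move=> wapp.
have pow0 n : 0 < 2 ^+ n :> R by rewrite exprn_gt0.
have /choice[uv uvP] : forall n : nat, exists p : (R -> V) * (R -> V),
    [/\ buc_on J p.1, buc_on J p.2 &
      forall t, J t -> rnorm (w t - (p.1 t + gamma t *: p.2 t)) <= (2 ^+ n)^-1 / 2].
  move=> n; have [|u [v uvw]] := wapp ((2 ^+ n)^-1 / 2).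
    by rewrite divr_gt0// invr_gt0.
  by exists (u, v).
have /choice[d dP] : forall n : nat, exists p : (R -> V) * (R -> V),
    [/\ buc_on J p.1, buc_on J p.2,
     forall t, J t -> p.1 t + gamma t *: p.2 t =
       ((uv n.+1).1 t - (uv n).1 t) + gamma t *: ((uv n.+1).2 t - (uv n).2 t),
     forall t, J t -> rnorm (p.1 t) <= 2 * (2 ^+ n)^-1 &
     forall t, J t -> rnorm (p.2 t) <= c0^-1 * (3 * (2 ^+ n)^-1)].
  move=> n; case: (uvP n) => u1 v1 e1; case: (uvP n.+1) => u2 v2 e2.
  have [||||u' [v' uv']] := controlled_decomposition (r := (2 ^+ n)^-1)
      (u := fun t => (uv n.+1).1 t - (uv n).1 t) (v := fun t => (uv n.+1).2 t - (uv n).2 t).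
  - by rewrite invr_gt0.
  - exact: buc_onB.
  - exact: buc_onB.
  - move=> t Jt; rewrite (_ : _ + _ = (w t - ((uv n).1 t + gamma t *: (uv n).2 t)) -
        (w t - ((uv n.+1).1 t + gamma t *: (uv n.+1).2 t))).
      apply: le_trans (rnormB _ _) _; apply: le_trans (lerD (e1 t Jt) (e2 t Jt)) _.
      have : (2 ^+ n.+1)^-1 <= (2 ^+ n)^-1 :> R.
        by rewrite lef_pV2 ?posrE// ler_eXn2l// ltr1n.
      by lra.
    by rewrite scalerBr opprB [RHS]addrC subrKA opprD addrACA.
  by exists (u', v').
pose S1 n t := (uv 0%N).1 t + \sum_(i < n) (d i).1 t.
pose S2 n t := (uv 0%N).2 t + \sum_(i < n) (d i).2 t.
have S1S n t : S1 n.+1 t = S1 n t + (d n).1 t by rewrite /S1 big_ord_recr/= addrA.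
have S2S n t : S2 n.+1 t = S2 n t + (d n).2 t by rewrite /S2 big_ord_recr/= addrA.
have S1J n : buc_on J (S1 n).
  elim: n => [|n IHn].
    apply: (@eq_buc_on _ _ _ _ (uv 0%N).1); last by case: (uvP 0%N).
    by move=> t _; rewrite /S1 big_ord0 addr0.
  apply: (@eq_buc_on _ _ _ _ (fun t => S1 n t + (d n).1 t)) => [t _|]; first by rewrite S1S.
  by apply: buc_onD => //; case: (dP n).
have S2J n : buc_on J (S2 n).
  elim: n => [|n IHn].
    apply: (@eq_buc_on _ _ _ _ (uv 0%N).2); last by case: (uvP 0%N).
    by move=> t _; rewrite /S2 big_ord0 addr0.
  apply: (@eq_buc_on _ _ _ _ (fun t => S2 n t + (d n).2 t)) => [t _|]; first by rewrite S2S.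
  by apply: buc_onD => //; case: (dP n).
have [n t Jt|U UJ S1U] := geometric_buc_on_limit (C := 2) S1J.
  by rewrite S1S addrC addKr; case: (dP n) => _ _ _ + _; apply.
have [n t Jt|W WJ S2W] := geometric_buc_on_limit (C := c0^-1 * 3) S2J.
  by rewrite S2S addrC addKr -mulrA; case: (dP n) => _ _ _ _; apply.
exists U, W; split => // t Jt.
have SE n : S1 n t + gamma t *: S2 n t = (uv n).1 t + gamma t *: (uv n).2 t.
  elim: n => [|n IHn]; first by rewrite /S1 /S2 !big_ord0 !addr0.
  rewrite S1S S2S scalerDr addrACA IHn.
  case: (dP n) => _ _ -> // _ _.
  by rewrite scalerBr addrACA !subrKC.
apply: (@rnorm_limit_unique R k V (fun n => S1 n t + gamma t *: S2 n t)); last first.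
  by apply: cvgD; [exact: S1U|apply: cvgZl_tmp; exact: S2W].
apply/rnorm_cvgP => e e0; exists (Num.truncn e^-1) => // n /= en.
rewrite SE rnorm_distC; case: (uvP n) => _ _ /(_ t Jt) h; apply: le_trans h _.
have : (2 ^+ n)^-1 <= e.
  rewrite -[leRHS]invrK lef_pV2 ?posrE ?invr_gt0//.
  apply: ltW; apply: lt_le_trans (truncnS_gt _) _.
  by rewrite -natrX ler_nat (leq_ltn_trans en)// ltn_expl.
have : 0 < (2 ^+ n)^-1 :> R by rewrite invr_gt0.
by lra.
Qed.

End Closedness.

(** * Means of functions on an upward closed set *)

Section HalfLineMeans.
Context (R : realType) (k : scalar_kind) (V : completeNormedModType (scalars R k)).
Local Notation K := (scalars R k).
Local Notation sr := (@scalar_of_real R k).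
Context (J : set R) (Jup : forall t s : R, J t -> t <= s -> J s).
Implicit Types (f g : R -> V) (t s h : R).

Definition bounded_integrable_on f := forall a b : R, J a -> a <= b ->
  exists x, is_bounded_integral a b f x.

Lemma bounded_integrable_onB f g : bounded_integrable_on f ->
  bounded_integrable_on g -> bounded_integrable_on (fun t => f t - g t).
Proof.
move=> fJ gJ a b Ja ab; have [x fx] := fJ a b Ja ab; have [y gy] := gJ a b Ja ab.
by exists (x - y); exact: bounded_integralB.
Qed.

Lemma bounded_integrable_on_addr f s : 0 <= s -> bounded_integrable_on f ->
  bounded_integrable_on (fun t => f (s + t)).
Proof.
move=> s0 fJ a b Ja ab; have [||x fx] := fJ (s + a) (s + b).
- by apply: Jup Ja _; lra.
- by lra.
by exists x; exact: bounded_integral_addr.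
Qed.

Lemma mean_sub_integral f h t : 0 < h -> J t -> bounded_integrable_on f ->
  exists2 x, is_bounded_integral 0 h (fun s => f (t + s) - f t) x &
    moving_mean h f t - f t = sr h^-1 *: x.
Proof.
move=> h0 Jt fJ; have [|x fx] := fJ t (t + h) Jt; first by lra.
exists (x - sr h *: f t).
  apply: bounded_integralB.
    by apply: bounded_integral_addr; rewrite addr0.
  by rewrite -[h in sr h](subr0 h); exact: bounded_integral_cst (ltW h0).
rewrite (meanE fx) scalerBr scalerA -scalar_of_realM mulVf ?gt_eqF//.
by rewrite scalar_of_real1 scale1r.
Qed.

Lemma mean_subf f g h t : 0 < h -> J t -> bounded_integrable_on f ->
  bounded_integrable_on g ->
  moving_mean h (fun s => f s - g s) t = moving_mean h f t - moving_mean h g t.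
Proof.
move=> h0 Jt fJ gJ; have [|x fx] := fJ t (t + h) Jt; first by lra.
have [|y gy] := gJ t (t + h) Jt; first by lra.
by rewrite (meanE fx) (meanE gy) (meanE (bounded_integralB fx gy)) scalerBr.
Qed.

Lemma mean_addr f h s t : 0 < h -> 0 <= s -> J t -> bounded_integrable_on f ->
  moving_mean h (fun r => f (r + s)) t = moving_mean h f (t + s).
Proof.
move=> h0 s0 Jt fJ.
have [||x fx] := fJ (s + t) (s + t + h).
- by apply: Jup Jt _; lra.
- by lra.
rewrite [t + s]addrC (meanE fx) (@meanE _ _ _ h t _ x)//.
rewrite -addrA in fx; have := bounded_integral_addr fx.
by apply: eq_bounded_integral => r _; rewrite addrC.
Qed.

Lemma mean_on_lipschitz f h C s t : 0 < h -> bounded_integrable_on f ->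
  J s -> J t ->
  (forall r, Num.min s t <= r <= Num.max s t + h -> rnorm (f r) <= C) ->
  rnorm (moving_mean h f s - moving_mean h f t) <= 2 * C / h * `|s - t|.
Proof.
move=> h0 fJ; wlog ts : s t / t <= s.
  move=> H Js Jt fC; have [ts|/ltW st] := leP t s; first exact: H.
  rewrite rnorm_distC distrC; apply: H => // r; rewrite minC maxC; exact: fC.
move=> _ Jt; rewrite (min_idPr ts) (max_idPl ts) => fC.
have [|x fx] := fJ t (s + h) Jt; first by lra.
rewrite ger0_norm ?subr_ge0// -{1}(subrKC t s).
apply: (mean_lipschitz h0 (x := x)); first by rewrite subr_ge0.
  by rewrite subrKC.
by move=> r; rewrite subrKC; exact: fC.
Qed.

Lemma mean_buc_on f h C : 0 < h -> bounded_integrable_on f ->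
  (forall t, J t -> rnorm (f t) <= C) -> buc_on J (moving_mean h f).
Proof.
move=> h0 fJ fC; split.
  exists C => t Jt; have [|x fx] := fJ t (t + h) Jt; first by lra.
  by apply: (mean_le h0 fx) => s /andP[ts _]; apply/fC/(Jup Jt).
move=> e e0; have L0 : 0 < `|2 * C / h| + 1 by rewrite ltr_wpDl.
exists (e / (`|2 * C / h| + 1)); first by rewrite divr_gt0.
move=> s t Js Jt st; apply: le_trans (mean_on_lipschitz (C := C) h0 fJ Js Jt _) _.
  move=> r /andP[+ _]; rewrite ge_min => /orP[sr|tr]; apply: fC.
    exact: Jup Js sr.
  exact: Jup Jt tr.
rewrite ltr_pdivlMr// in st; apply: le_trans (ltW st).
rewrite mulrC ler_wpM2l//; apply: le_trans (ler_norm _) _.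
by rewrite lerDl.
Qed.

End HalfLineMeans.

(** * Differences in the vector sum *)

Section DifferencesInSum.
Context (R : realType) (k : scalar_kind) (V : completeNormedModType (scalars R k)).
Local Notation K := (scalars R k).
Local Notation sr := (@scalar_of_real R k).
Context (gamma : R -> K^o) (c0 C0 : R).
Hypotheses (c0_gt0 : 0 < c0) (gamma_ge : forall t, c0 <= rnorm (gamma t))
  (gamma_le : forall t, rnorm (gamma t) <= C0)
  (gamma_continuous : forall t, forall e : R, 0 < e -> exists2 d : R, 0 < d &
    forall s, `|s - t| < d -> rnorm (gamma s - gamma t) <= e).
Hypothesis gamma_integrable : forall v : R -> V, buc_on setT v ->
  bounded_integrable_on setT (fun t => gamma t *: v t).
Hypothesis gamma_mean : forall v : R -> V, buc_on setT v -> forall h : R, 0 < h ->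
  exists2 v' : R -> V, buc_on setT v' &
    forall t, moving_mean h (fun t => gamma t *: v t) t = gamma t *: v' t.
Context (J : set R) (Jup : forall t s : R, J t -> t <= s -> J s).
Hypothesis J_retract : forall d : R, 0 < d -> exists pi : R -> R,
  [/\ forall t, J (pi t), forall s t, `|pi s - pi t| <= `|s - t| &
      forall t, J t -> `|t - pi t| < d].

Definition in_sum_on (D : R -> V) : Prop := exists u v : R -> V,
  [/\ buc_on J u, buc_on J v & forall t, J t -> D t = u t + gamma t *: v t].

Let C0_gt0 : 0 < C0.
Proof. exact: lt_le_trans c0_gt0 (le_trans (gamma_ge 0) (gamma_le 0)). Qed.

Let gammaVZ t (x : V) : rnorm ((gamma t)^-1 *: x) <= c0^-1 * rnorm x.
Proof. exact: rnorm_gammaV_scale. Qed.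

Lemma in_sum_on_bounded D : in_sum_on D -> exists M, forall t, J t -> rnorm (D t) <= M.
Proof.
move=> [u [v [[[M uM] _] [[N vN] _] Duv]]]; exists (M + C0 * N) => t Jt.
rewrite Duv//; apply: le_trans (rnormD _ _) _; rewrite rnormZ lerD ?uM//.
by rewrite ler_pM ?rnorm_ge0 ?gamma_le ?vN.
Qed.

Lemma in_sum_on_continuous D : in_sum_on D -> continuous_on J D.
Proof.
move=> [u [v [[_ uc] [[N vN] vc] Duv]]] t Jt e e0.
have e30 : 0 < e / 3 by lra.
have N0 : 0 < `|N| + 1 by rewrite ltr_wpDl.
have [d1 d10 ud] := uc _ e30.
have [|d2 d20 vd] := vc (e / 3 / C0); first by rewrite divr_gt0.
have [|d3 d30 gd] := gamma_continuous t (e := e / 3 / (`|N| + 1)).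
  by rewrite divr_gt0.
exists (Num.min d1 (Num.min d2 d3)); first by rewrite !lt_min d10 d20 d30.
move=> s Js; rewrite !lt_min => /and3P[s1 s2 s3]; rewrite !Duv//.
have -> : u s + gamma s *: v s - (u t + gamma t *: v t) = (u s - u t) +
    ((gamma s - gamma t) *: v s + gamma t *: (v s - v t)).
  by rewrite scalerBl scalerBr subrKA opprD addrACA.
apply: le_trans (rnormD _ _) _; apply: le_trans (lerD (lexx _) (rnormD _ _)) _.
have := ud s t Js Jt s1.
have : rnorm ((gamma s - gamma t) *: v s) <= e / 3.
  rewrite rnormZ -[leRHS](@divfK _ (`|N| + 1)) ?gt_eqF// ler_pM ?rnorm_ge0 ?gd//.
  by rewrite (le_trans (vN _ Js))// (le_trans (ler_norm _))// lerDl.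
have : rnorm (gamma t *: (v s - v t)) <= e / 3.
  rewrite rnormZ -[leRHS](@divfK _ C0) ?gt_eqF// mulrC ler_pM ?rnorm_ge0//.
  exact: vd.
by lra.
Qed.

(** Precomposition with a contraction into [J] that hardly moves the points of
    [J]; uniform continuity makes the change small. *)
Lemma buc_on_approx_line v e : 0 < e -> buc_on J v ->
  exists2 v' : R -> V, buc_on setT v' & forall t, J t -> rnorm (v t - v' t) <= e.
Proof.
move=> e0 [[M vM] vc]; have [d d0 vd] := vc e e0.
have [pi [piJ piL pid]] := J_retract d0.
exists (fun t => v (pi t)); last by move=> t Jt; apply: vd => //; exact: pid.
split; first by exists M => t _; exact: vM.
move=> r /vc[d' d'0 vd']; exists d' => // s t _ _ st; apply: vd' => //.
exact: le_lt_trans st.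
Qed.

(** For [D = u + gamma v] the mean of [u] is uniformly close to [u], while the
    mean of [gamma v] is again [gamma] times a uniformly continuous function.
    The second fact lives on the whole line, so [v] is first replaced by a
    function on the line up to a small error, which is charged to [u]. *)
Lemma normalized_remainder_oscillation D : in_sum_on D -> bounded_integrable_on J D ->
  forall e : R, 0 < e -> exists2 delta0 : R, 0 < delta0 &
  forall delta, 0 < delta < delta0 -> exists2 b0 : R, 0 < b0 &
  forall s t, J s -> J t -> `|s - t| < b0 ->
    rnorm ((gamma s)^-1 *: (D s - moving_mean delta D s) -
           (gamma t)^-1 *: (D t - moving_mean delta D t)) <= e.
Proof.
move=> [u [v [[_ uc] vJ Duv]]] DJ e e0.
have [|v1 v1buc v1e] := buc_on_approx_line (e := c0 * e / 16 / C0) _ vJ.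
  by rewrite !divr_gt0// mulr_gt0.
have [|d0 d00 ud] := uc (c0 * e / 8); first by rewrite divr_gt0// mulr_gt0.
exists d0 => // delta /andP[delta0 deltad].
have [v2 v2buc v2E] := gamma_mean v1buc delta0.
have [_ /(_ (e / 2))[|b0 b00 vd]] := buc_onB v1buc v2buc; first by lra.
exists b0 => // s t Js Jt st.
pose r x := D x - gamma x *: v1 x.
have g1J : bounded_integrable_on J (fun x => gamma x *: v1 x).
  by move=> a b Ja; exact: gamma_integrable.
have rJ : bounded_integrable_on J r by exact: bounded_integrable_onB.
have DE x : J x -> D x - moving_mean delta D x =
    gamma x *: (v1 x - v2 x) - (moving_mean delta r x - r x).
  move=> Jx; rewrite (mean_subf delta0 Jx DJ g1J) v2E scalerBr /r.
  by rewrite !opprB addrACA subrKC addKr.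
have r_le x : J x -> rnorm (moving_mean delta r x - r x) <= c0 * e / 4.
  move=> Jx; have [|y ry] := rJ x (x + delta) Jx; first by lra.
  apply: (mean_sub_le delta0 ry) => z /andP[xz zx].
  have Jz : J z by exact: Jup Jx xz.
  have rE w : J w -> r w = u w + gamma w *: (v w - v1 w).
    by move=> Jw; rewrite /r Duv// scalerBr addrA.
  have small w : J w -> rnorm (gamma w *: (v w - v1 w)) <= c0 * e / 16.
    move=> Jw; rewrite rnormZ -[leRHS](@divfK _ C0) ?gt_eqF// mulrC.
    by rewrite ler_pM ?rnorm_ge0 ?v1e.
  rewrite !rE// opprD addrACA; apply: le_trans (rnormD _ _) _.
  apply: le_trans (lerD (lexx _) (rnormB _ _)) _.
  have : rnorm (u z - u x) <= c0 * e / 8.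
    by apply: ud => //; rewrite ger0_norm ?subr_ge0//; lra.
  by have := small x Jx; have := small z Jz; lra.
have part x : J x -> (gamma x)^-1 *: (D x - moving_mean delta D x) =
    (v1 x - v2 x) - (gamma x)^-1 *: (moving_mean delta r x - r x).
  move=> Jx; rewrite DE// scalerBr scalerA mulVf ?scale1r//.
  exact: gamma_neq0 c0_gt0 gamma_ge x.
have rV x : J x -> rnorm ((gamma x)^-1 *: (moving_mean delta r x - r x)) <= e / 4.
  move=> Jx; apply: le_trans (gammaVZ _ _) _; rewrite ler_pdivrMl//.
  by rewrite mulrA r_le.
have subACA (a b c d : V) : a - b - (c - d) = (a - c) - (b - d).
  by rewrite !opprD !opprK addrACA.
rewrite !part// subACA; apply: le_trans (rnormB _ _) _.
apply: le_trans (lerD (lexx _) (rnormB _ _)) _.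
by have := vd s t I I st; have := rV s Js; have := rV t Jt; lra.
Qed.

Context (f : R -> V).
Hypothesis f_limit : forall a b, J a -> a <= b -> ae_simple_limit a b f.
Hypothesis f_difference : forall a, 0 < a -> in_sum_on (fun t => f (t + a) - f t).

Let difference_in_sum a : 0 <= a -> in_sum_on (fun t => f (t + a) - f t).
Proof.
rewrite le_eqVlt => /predU1P[<-|]; last exact: f_difference.
have b0 : buc_on J (fun=> 0 : V).
  split; first by exists 0 => t _; rewrite rnorm0.
  by move=> e e0; exists 1 => // s t _ _ _; rewrite subrr rnorm0 ltW.
exists (fun=> 0), (fun=> 0); split => // t _.
by rewrite addr0 subrr scaler0 addr0.
Qed.

Let difference_bound (h : R) : 0 < h ->
  exists C, forall t s, J t -> 0 <= s <= h -> rnorm (f (t + s) - f t) <= C.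
Proof.
move=> h0; apply: (uniform_difference_bound Jup f_limit h0) => s s0.
exact: in_sum_on_bounded (f_difference s0).
Qed.

Let f_locally_bounded (r t : R) : 0 < r -> J t ->
  exists M, forall s, J s -> `|s - t| <= r -> rnorm (f s) <= M.
Proof.
move=> r0 Jt; have [C fC] := difference_bound r0.
exists (rnorm (f t) + C) => s Js; rewrite ler_norml => /andP[rs sr_].
have [st|/ltW ts] := leP s t.
  have := fC s (t - s) Js; rewrite subrKC => fst.
  rewrite -(subKr (f t) (f s)); apply: le_trans (rnormB _ _) _.
  by rewrite lerD2l fst//; lra.
have := fC t (s - t) Jt; rewrite subrKC => fst.
rewrite -(subrKC (f t) (f s)); apply: le_trans (rnormD _ _) _.
by rewrite lerD2l fst//; lra.
Qed.

Let fJ : bounded_integrable_on J f.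
Proof.
move=> a b Ja ab; have [|M fM] := @f_locally_bounded (b - a + 1) a _ Ja; first by lra.
apply: (bounded_integral_exists (f_limit Ja ab) (C := M)) => t /andP[at_ tb].
by apply: fM; [exact: Jup Ja at_|rewrite ger0_norm; lra].
Qed.

Let continuous_on_bounded_integrable (g : R -> V) : continuous_on J g ->
  (forall a b, J a -> a <= b -> exists M, forall t, a <= t <= b -> rnorm (g t) <= M) ->
  bounded_integrable_on J g.
Proof.
move=> gc gM a b Ja ab; have [M {}gM] := gM a b Ja ab.
apply: bounded_integral_exists gM.
apply: continuous_on_ae_simple_limit gc => t /=.
by rewrite in_itv/= => /andP[at_ _]; exact: Jup Ja at_.
Qed.

Section Smoothing.
Context (h C : R) (h0 : 0 < h)
  (fC : forall t s, J t -> 0 <= s <= h -> rnorm (f (t + s) - f t) <= C).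

Let w t := f t - moving_mean h f t.

Let C_ge0 t : J t -> 0 <= C.
Proof.
move=> Jt; have h00 : (0 : R) <= 0 <= h by rewrite lexx ltW.
exact: le_trans (rnorm_ge0 _) (fC Jt h00).
Qed.

Let DJ s : 0 <= s -> bounded_integrable_on J (fun t => f (t + s) - f t).
Proof.
move=> s0; apply: bounded_integrable_onB => //.
move=> a b Ja ab; have [x fx] := bounded_integrable_on_addr Jup s0 fJ Ja ab.
by exists x; apply: eq_bounded_integral fx => t _; rewrite addrC.
Qed.

(** Bounded convergence under the average over [s], since each difference of
    [f] is continuous. *)
Lemma sub_mean_continuous : continuous_on J w.
Proof.
move=> t Jt e e0; apply: contrapT => ncont.
have /choice[tt ttP] : forall n : nat, exists s, [/\ J s, `|s - t| < n.+1%:R^-1 &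
    e < rnorm (w s - w t)].
  move=> n; apply: contrapT => H; apply: ncont; exists n.+1%:R^-1.
    by rewrite invr_gt0.
  move=> s Js st; rewrite leNgt; apply/negP => es; apply: H.
  by exists s.
have /choice[x xP] : forall n : nat, exists x,
    is_bounded_integral 0 h (fun s => (f (tt n + s) - f (tt n)) - (f (t + s) - f t)) x /\
    w (tt n) - w t = - (sr h^-1 *: x).
  move=> n; have [Jn _ _] := ttP n.
  have [x fx wx] := mean_sub_integral h0 Jn fJ.
  have [y fy wy] := mean_sub_integral h0 Jt fJ.
  exists (x - y); split; first exact: bounded_integralB.
  by rewrite /w -[f (tt n) - _]opprB -[f t - _]opprB wx wy -opprD -scalerN -scalerDr.
have [||t1 t1h e1 e10|m [n]] := iterated_bounded_integral_small (C := C + C)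
    (f := fun _ n s => (f (tt n + s) - f (tt n)) - (f (t + s) - f t))
    (x := fun _ n => x n) _ (fun _ n => (xP n).1) _ _ (mulr_gt0 h0 e0).
- by rewrite addr_ge0 ?(C_ge0 Jt).
- move=> _ n s sh; have [Jn _ _] := ttP n.
  by apply: le_trans (rnormB _ _) _; rewrite lerD// fC.
- exists 0%N => _ _.
  have [|d d0 Dd] := in_sum_on_continuous (difference_in_sum (_ : 0 <= t1)) Jt e10.
    by case/andP: t1h.
  exists (Num.truncn d^-1) => n dn; have [Jn tn _] := ttP n.
  apply: Dd => //; apply: lt_le_trans tn _.
  rewrite -[leRHS]invrK lef_pV2 ?posrE ?invr_gt0//.
  by apply: ltW; apply: lt_le_trans (truncnS_gt _) _; rewrite ler_nat ltnS.
case: (ttP n) => _ _; rewrite (xP n).2 rnormN rnormZr ger0_norm; last by rewrite invr_ge0 ltW.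
by rewrite ltr_pdivlMl// => /lt_trans/[apply]; rewrite ltxx.
Qed.

Section Delta.
Context (delta : R) (delta0 : (0 : R) < delta).

Let g := moving_mean delta f.

Let g_lipschitz (t r : R) : 0 < r -> J t -> exists L, forall s s', J s -> J s' ->
  `|s - t| <= r -> `|s' - t| <= r -> rnorm (g s - g s') <= L * `|s - s'|.
Proof.
move=> r0 Jt; have [|M fM] := @f_locally_bounded (r + delta) t _ Jt; first exact: addr_gt0.
have delta_gt0 := delta0; exists (2 * M / delta) => s s' Js Js'; rewrite !ler_norml => /andP[rs sr1] /andP[rs' sr2].
apply: (mean_on_lipschitz delta0 fJ) => // z /andP[]; rewrite ge_min => zmin zmax.
have zmax' : z - delta <= s \/ z - delta <= s'.
  by apply/orP; rewrite -le_max lerBlDr.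
apply: fM; first by case/orP: zmin; exact: Jup.
by rewrite ler_norml; apply/andP; split; case/orP: zmin => ?; case: zmax' => ?; lra.
Qed.

Lemma mean_bounded_integrable_on : bounded_integrable_on J g.
Proof.
apply: continuous_on_bounded_integrable.
  move=> t Jt e e0; have [L gL] := g_lipschitz ltr01 Jt.
  have L0 : 0 < `|L| + 1 by rewrite ltr_wpDl.
  exists (Num.min 1 (e / (`|L| + 1))); first by rewrite lt_min ltr01 divr_gt0.
  move=> s Js; rewrite lt_min => /andP[s1 se].
  apply: le_trans (gL s t Js Jt (ltW s1) _) _; first by rewrite subrr normr0 ler01.
  rewrite ltr_pdivlMr// in se; apply: le_trans (ltW se); rewrite mulrC ler_wpM2l//.
  by apply: le_trans (ler_norm _) _; rewrite lerDl.
move=> a b Ja ab; have delta_gt0 := delta0.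
have [|M fM] := @f_locally_bounded (b - a + delta) a _ Ja; first by lra.
exists M => t /andP[at_ tb]; have Jt := Jup Ja at_.
have [|x fx] := fJ (b := t + delta) Jt; first by rewrite lerDl ltW.
apply: (mean_le delta0 fx) => s /andP[ts st]; apply: fM; first exact: Jup Jt ts.
by rewrite ger0_norm; lra.
Qed.

Lemma mean_difference t s : 0 <= s -> J t ->
  g (t + s) - g t = moving_mean delta (fun r => f (r + s) - f r) t.
Proof.
move=> s0 Jt; rewrite (mean_subf (f := fun r => f (r + s)) delta0 Jt)//.
  by rewrite (mean_addr Jup).
move=> a b Ja ab; have [x fx] := bounded_integrable_on_addr Jup s0 fJ Ja ab.
by exists x; apply: eq_bounded_integral fx => r _; rewrite addrC.
Qed.

(** The function is an average of means of the differences of [f], all of which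
    are Lipschitz with constant [2 * C / delta]. *)
Lemma sub_mean_mean_buc : buc_on J (fun t => g t - moving_mean h g t).
Proof.
have gJ := mean_bounded_integrable_on.
have Dbd s : 0 <= s <= h -> forall t, J t -> rnorm (f (t + s) - f t) <= C.
  by move=> sh t Jt; exact: fC.
split.
  exists C => t Jt; have [x gx gE] := mean_sub_integral h0 Jt gJ.
  rewrite rnorm_distC gE; apply: rnorm_scale_integral => //.
  rewrite -[h in h * C]subr0; apply: (bounded_integral_le_cst (ltW h0) gx) => s sh.
  have s0 : 0 <= s by case/andP: sh.
  rewrite mean_difference//.
  have [|y Dy] := DJ s0 (b := t + delta) Jt; first by rewrite lerDl ltW.
  apply: (mean_le delta0 Dy) => r /andP[tr _].
  exact: fC (Jup Jt tr) sh.
move=> e e0; pose L := 2 * C / delta; have L0 : 0 < `|L| + 1 by rewrite ltr_wpDl.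
exists (e / (`|L| + 1)); first by rewrite divr_gt0.
move=> s t Js Jt st.
have [x gx gxE] := mean_sub_integral h0 Js gJ.
have [y gy gyE] := mean_sub_integral h0 Jt gJ.
have -> : g s - moving_mean h g s - (g t - moving_mean h g t) =
    - ((moving_mean h g s - g s) - (moving_mean h g t - g t)) by rewrite !opprB addrC.
rewrite gxE gyE rnormN -scalerBr.
apply: (@le_trans _ _ (L * `|s - t|)); last first.
  rewrite ltr_pdivlMr// in st; apply: le_trans (ltW st); rewrite mulrC ler_wpM2l//.
  by apply: le_trans (ler_norm _) _; rewrite lerDl.
apply: rnorm_scale_integral => //; rewrite -{1}[h]subr0.
apply: (bounded_integral_le_cst (ltW h0) (bounded_integralB gx gy)) => r rh.
have r0 : 0 <= r by case/andP: rh.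
rewrite !mean_difference//; apply: (mean_on_lipschitz delta0 (DJ r0) Js Jt).
move=> z /andP[+ _]; rewrite ge_min => /orP[sz|tz]; apply: fC rh.
  exact: Jup Js sz.
exact: Jup Jt tz.
Qed.

Let p t := f t - g t.

(** The part of [w] that should be accounted for by the second summand. *)
Definition normalized_remainder t : V := (gamma t)^-1 *: (p t - moving_mean h p t).

Let pJ : bounded_integrable_on J p.
Proof. by apply: bounded_integrable_onB => //; exact: mean_bounded_integrable_on. Qed.

Lemma p_difference t s : 0 <= s -> J t -> p (t + s) - p t =
  (f (t + s) - f t) - moving_mean delta (fun r => f (r + s) - f r) t.
Proof.
by move=> s0 Jt; rewrite -mean_difference// /p !opprD !opprK addrACA.
Qed.

Lemma p_difference_le t s : 0 <= s <= h -> J t -> rnorm (p (t + s) - p t) <= C + C.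
Proof.
move=> sh Jt; have s0 : 0 <= s by case/andP: sh.
rewrite p_difference//; apply: le_trans (rnormB _ _) _; rewrite lerD ?fC//.
have [|y Dy] := DJ s0 (b := t + delta) Jt; first by rewrite lerDl ltW.
by apply: (mean_le delta0 Dy) => r /andP[tr _]; apply: fC sh; exact: Jup Jt tr.
Qed.

Lemma normalized_remainder_sub s t : J s -> J t -> exists2 x : V,
  is_bounded_integral 0 h (fun r => (gamma s)^-1 *: (p (s + r) - p s) -
    (gamma t)^-1 *: (p (t + r) - p t)) x &
  normalized_remainder s - normalized_remainder t = - (sr h^-1 *: x).
Proof.
move=> Js Jt; have [x px pxE] := mean_sub_integral h0 Js pJ.
have [y py pyE] := mean_sub_integral h0 Jt pJ.
exists ((gamma s)^-1 *: x - (gamma t)^-1 *: y).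
  by apply: bounded_integralB; exact: bounded_integralZ.
rewrite /normalized_remainder -(opprB (moving_mean h p s)) -(opprB (moving_mean h p t)) pxE pyE.
rewrite !scalerN opprK scalerBr !scalerA opprB addrC.
by rewrite ![(gamma _)^-1 * _]mulrC.
Qed.

Lemma sub_mean_decomposition t : J t ->
  w t = (g t - moving_mean h g t) + gamma t *: normalized_remainder t.
Proof.
move=> Jt; rewrite /normalized_remainder (gammaVK c0_gt0 gamma_ge).
rewrite (mean_subf h0 Jt fJ mean_bounded_integrable_on) /w /p.
have -> : f t - g t - (moving_mean h f t - moving_mean h g t) =
    (f t - moving_mean h f t) - (g t - moving_mean h g t).
  by rewrite !opprD !opprK addrACA.
by rewrite subrKC.
Qed.

Lemma normalized_remainder_le t : J t ->
  rnorm (normalized_remainder t) <= c0^-1 * (C + C).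
Proof.
move=> Jt; apply: le_trans (gammaVZ _ _) _; rewrite ler_wpM2l ?invr_ge0 ?(ltW c0_gt0)//.
have [x px pxE] := mean_sub_integral h0 Jt pJ.
rewrite rnorm_distC pxE; apply: rnorm_scale_integral => //; rewrite -{1}[h]subr0.
apply: (bounded_integral_le_cst (ltW h0) px) => s sh.
exact: p_difference_le.
Qed.

Lemma normalized_remainder_continuous : continuous_on J normalized_remainder.
Proof.
pose a t := w t - (g t - moving_mean h g t).
have aE t : J t -> normalized_remainder t = (gamma t)^-1 *: a t.
  move=> Jt; rewrite /a sub_mean_decomposition// addrC addKr.
  by rewrite scalerA mulVf ?scale1r//; exact: gamma_neq0 c0_gt0 gamma_ge t.
move=> t Jt e e0; have [_ Pc] := sub_mean_mean_buc.
have [|d1 d10 wd] := sub_mean_continuous Jt (e := c0 * e / 3); first by rewrite divr_gt0// mulr_gt0.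
have [|d2 d20 Pd] := Pc (c0 * e / 3); first by rewrite divr_gt0// mulr_gt0.
have N0 : 0 < rnorm (a t) + 1 by rewrite ltr_wpDl// rnorm_ge0.
have [|d3 d30 gd] := gamma_continuous t (e := c0 * (c0 * (e / 3 / (rnorm (a t) + 1)))).
  by rewrite !mulr_gt0// ?invr_gt0//; lra.
exists (Num.min d1 (Num.min d2 d3)); first by rewrite !lt_min d10 d20 d30.
move=> s Js; rewrite !lt_min => /and3P[s1 s2 s3]; rewrite !aE//.
have -> : (gamma s)^-1 *: a s - (gamma t)^-1 *: a t =
    (gamma s)^-1 *: (a s - a t) + ((gamma s)^-1 - (gamma t)^-1) *: a t.
  by rewrite (scalerBr _ (a s)) scalerBl subrKA.
apply: le_trans (rnormD _ _) _.
have : rnorm ((gamma s)^-1 *: (a s - a t)) <= e * 2 / 3.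
  apply: le_trans (gammaVZ _ _) _; rewrite ler_pdivrMl//.
  have -> : a s - a t = (w s - w t) - ((g s - moving_mean h g s) - (g t - moving_mean h g t)).
    by rewrite /a !opprD !opprK addrACA.
  apply: le_trans (rnormB _ _) _.
  by have := wd s Js s1; have := Pd s t Js Jt s2; lra.
have : rnorm (((gamma s)^-1 - (gamma t)^-1) *: a t) <= e / 3.
  rewrite rnormZ -[leRHS](@divfK _ (rnorm (a t) + 1)) ?gt_eqF// ler_pM ?rnorm_ge0//.
    apply: le_trans (gammaV_sub c0_gt0 gamma_ge s t) _.
    by rewrite -!ler_pdivlMl ?invr_gt0// !invrK gd.
  by rewrite lerDl.
by lra.
Qed.

Lemma normalized_remainder_bounded_integrable :
  bounded_integrable_on J normalized_remainder.
Proof.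
apply: continuous_on_bounded_integrable normalized_remainder_continuous _.
move=> a b Ja ab; exists (c0^-1 * (C + C)) => t /andP[at_ _].
by apply: normalized_remainder_le; exact: Jup Ja at_.
Qed.

End Delta.

(** If no [delta] worked, then for each [m] the choice [delta = 1 / (m + 1)] would
    fail at pairs of points, indexed by [n], whose distance tends to zero.  The
    differences of the remainder at these pairs are averages over [s] of functions
    that, for each fixed [s], are small once [m] and then [n] are large. *)
Lemma normalized_remainder_small_oscillation (e : R) : 0 < e ->
  exists2 delta : R, 0 < delta & exists2 b0 : R, 0 < b0 &
  forall s t, J s -> J t -> `|s - t| < b0 ->
    rnorm (normalized_remainder delta s - normalized_remainder delta t) <= e.
Proof.
move=> e0; apply: contrapT => nosc.
have delta0 (m : nat) : (0 : R) < m.+1%:R^-1 by rewrite invr_gt0.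
have /choice[st stP] : forall p : nat * nat, exists q : R * R,
    [/\ J q.1, J q.2, `|q.1 - q.2| < p.2.+1%:R^-1 &
      e < rnorm (normalized_remainder p.1.+1%:R^-1 q.1 -
                 normalized_remainder p.1.+1%:R^-1 q.2)].
  move=> [m n]; apply: contrapT => H; apply: nosc; exists m.+1%:R^-1; first exact: delta0.
  exists n.+1%:R^-1; first by rewrite invr_gt0.
  move=> s t Js Jt st; rewrite leNgt; apply/negP => es; apply: H.
  by exists (s, t).
pose p m t := f t - moving_mean m.+1%:R^-1 f t.
pose F (m n : nat) r := (gamma (st (m, n)).1)^-1 *: (p m ((st (m, n)).1 + r) - p m (st (m, n)).1) -
  (gamma (st (m, n)).2)^-1 *: (p m ((st (m, n)).2 + r) - p m (st (m, n)).2).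
have /choice[x xP] : forall q : nat * nat, exists x,
    is_bounded_integral 0 h (F q.1 q.2) x /\
    normalized_remainder q.1.+1%:R^-1 (st q).1 - normalized_remainder q.1.+1%:R^-1 (st q).2 =
    - (sr h^-1 *: x).
  move=> [m n]; have [Js Jt _ _] := stP (m, n).
  by have [x Fx xE] := normalized_remainder_sub (delta0 m) Js Jt; exists x.
have Jst : J (st (0, 0)%N).1 by case: (stP (0, 0)%N).
have C2_ge0 : 0 <= C + C by rewrite addr_ge0 ?(C_ge0 Jst).
have V0 : 0 <= c0^-1 by rewrite invr_ge0 ltW.
have [||r rh e1 e10|m [n]] := iterated_bounded_integral_small
    (C := c0^-1 * (C + C) + c0^-1 * (C + C))
    (f := F) (x := fun m n => x (m, n)) _ (fun m n => (xP (m, n)).1) _ _ (mulr_gt0 h0 e0).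
- by rewrite addr_ge0// mulr_ge0.
- move=> m n r rh; have [Js Jt _ _] := stP (m, n).
  have pl t : J t -> rnorm ((gamma t)^-1 *: (p m (t + r) - p m t)) <= c0^-1 * (C + C).
    move=> Jt'; apply: le_trans (gammaVZ _ _) _; rewrite ler_wpM2l//.
    exact: p_difference_le.
  by apply: le_trans (rnormB _ _) _; rewrite lerD// pl.
- have r0 : 0 <= r by case/andP: rh.
  have natV (d : R) (i : nat) : 0 < d -> (Num.truncn d^-1 <= i)%N -> i.+1%:R^-1 < d.
    move=> d0 di; rewrite -[ltRHS]invrK ltf_pV2 ?posrE ?invr_gt0//.
    by apply: lt_le_trans (truncnS_gt _) _; rewrite ler_nat ltnS.
  have [d d0 dP] := normalized_remainder_oscillation (difference_in_sum r0) (DJ r0) e10.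
  exists (Num.truncn d^-1) => m dm.
  have [|b b0 bP] := dP m.+1%:R^-1; first by rewrite delta0/= natV.
  exists (Num.truncn b^-1) => n bn; have [Js Jt st_lt _] := stP (m, n).
  rewrite /F /p !(p_difference (delta0 m))//.
  by apply: bP => //; exact: lt_trans st_lt (natV _ _ b0 bn).
case: (stP (m, n)) => _ _ _; rewrite (xP (m, n)).2 rnormN rnormZr ger0_norm; last by rewrite invr_ge0 ltW.
by rewrite ltr_pdivlMl// => /lt_trans/[apply]; rewrite ltxx.
Qed.

(** A mean over a window shorter than the scale of the small oscillations makes
    the remainder uniformly continuous while changing it little. *)
Lemma sub_mean_approximation (e : R) : 0 < e -> exists u v : R -> V,
  [/\ buc_on J u, buc_on J v &
    forall t, J t -> rnorm (w t - (u t + gamma t *: v t)) <= e].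
Proof.
move=> e0; have [|delta delta0 [b0 b00 osc]] := @normalized_remainder_small_oscillation (e / C0).
  by rewrite divr_gt0.
pose y := normalized_remainder delta.
have yJ : bounded_integrable_on J y by exact: normalized_remainder_bounded_integrable.
have b20 : 0 < b0 / 2 by lra.
exists (fun t => moving_mean delta f t - moving_mean h (moving_mean delta f) t), (moving_mean (b0 / 2) y); split.
- exact: sub_mean_mean_buc.
- apply: (mean_buc_on Jup b20 yJ (C := c0^-1 * (C + C))) => t.
  exact: normalized_remainder_le.
move=> t Jt; rewrite (sub_mean_decomposition delta0)// opprD addrACA subrr add0r.
rewrite -scalerBr rnormZ rnorm_distC -[leRHS](@divfK _ C0) ?gt_eqF// mulrC.
rewrite ler_pM ?rnorm_ge0//.
have [|x yx] := yJ t (t + b0 / 2) Jt; first by lra.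
apply: (mean_sub_le b20 yx) => s /andP[ts st].
apply: osc => //; first exact: Jup Jt ts.
by rewrite ger0_norm ?subr_ge0//; lra.
Qed.

End Smoothing.

Lemma sub_mean_approximable (h e : R) : 0 < h -> 0 < e -> exists u v : R -> V,
  [/\ buc_on J u, buc_on J v &
    forall t, J t -> rnorm (f t - moving_mean h f t - (u t + gamma t *: v t)) <= e].
Proof. by move=> h0 e0; have [C fC] := difference_bound h0; exact: (sub_mean_approximation h0 fC e0). Qed.

End DifferencesInSum.

(** * Half-lines *)

Section HalfLines.
Context (R : realType) (J : set R).
Hypothesis HJ : [\/ exists alpha : R, J = `[alpha, +oo[%classic,
  exists alpha : R, J = `]alpha, +oo[%classic | J = [set: R]].

Let half_lineP : J = [set: R] \/
  exists2 alpha : R, (forall t, alpha < t -> J t) & (forall t, J t -> alpha <= t).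
Proof.
case: HJ => [[alpha ->]|[alpha ->]|->]; [right|right|by left]; exists alpha => t /=;
  rewrite in_itv/= andbT//; exact: ltW.
Qed.

Lemma half_line_up (t s : R) : J t -> t <= s -> J s.
Proof.
case: HJ => [[alpha ->]|[alpha ->]|->]//=; rewrite !in_itv/= !andbT.
  exact: le_trans.
exact: lt_le_trans.
Qed.

(** For an open half-line the projection has to stop short of the endpoint, which
    costs less than [d]. *)
Lemma half_line_retract (d : R) : 0 < d -> exists pi : R -> R,
  [/\ forall t, J (pi t), forall s t, `|pi s - pi t| <= `|s - t| &
      forall t, J t -> `|t - pi t| < d].
Proof.
move=> d0; have [->|[alpha Ja aJ]] := half_lineP.
  by exists id; split => // t _; rewrite subrr normr0.
exists (fun t => Num.max t (alpha + d / 2)); split.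
- by move=> t; apply: Ja; rewrite lt_max; apply/orP; right; lra.
- move=> s t; have := ler_norm (s - t); have := ler_norm (t - s).
  rewrite (distrC t s) ler_norml /Num.max => ? ?.
  by have := normr_ge0 (s - t) => ?; case: ltP => ?; case: ltP => ?; apply/andP; split; lra.
- move=> t /aJ at_; rewrite ltr_norml /Num.max.
  by case: (ltP t (alpha + d / 2)) => ?; apply/andP; split; lra.
Qed.

Lemma half_line_cutoff : exists (eta : R -> R) (T0 : R),
  [/\ forall t, 0 <= eta t <= 1, forall s t, `|eta s - eta t| <= `|s - t|,
      forall t, ~ J t -> eta t = 0 & forall t, J t -> T0 <= `|t| -> eta t = 1].
Proof.
have [->|[alpha Ja aJ]] := half_lineP.
  exists (fun=> 1), 0; split => // [t|s t|t]; first by rewrite ler01 lexx.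
    by rewrite subrr normr0.
  by move=> nt; exfalso; apply: nt.
exists (fun t => clamp01 (t - alpha)), (`|alpha| + 1); split.
- by move=> t; exact: clamp01_itv.
- by move=> s t; apply: le_trans (clamp01_lipschitz _ _) _; rewrite opprB addrA subrK.
- move=> t Jt; apply: clamp01_le0; rewrite subr_le0 leNgt; apply/negP => at_.
  by apply: Jt; exact: Ja.
- move=> t /aJ at_ at1; apply: clamp01_ge1.
  have := ler_norm alpha; have := ler_norm (- alpha); rewrite normrN.
  by move: at1; case: (ltP t 0) => t0; [rewrite (ltr0_norm t0)|rewrite (ger0_norm t0)]; lra.
Qed.

End HalfLines.

(** * From the upper limit to a bound far out *)

Section LimsupNorm.
Context (R : realType) (k : scalar_kind) (V : normedModType (scalars R k)).

Lemma limf_esup_le_near (F : set_system R) (FF : Filter F) (u : R -> V) (r e : R) : 0 < e ->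
  (limf_esup (fun t => (rnorm (u t))%:E) F <= r%:E)%E ->
  \forall t \near F, rnorm (u t) <= r + e.
Proof.
move=> e0 ur.
have : (limf_esup (fun t => (rnorm (u t))%:E) F < (r + e)%:E)%E.
  by apply: le_lt_trans ur _; rewrite lte_fin ltrDl.
move=> /ereal_inf_lt[_ [A FA <-] uA]; apply: filterS FA => t At.
rewrite -lee_fin; apply: le_trans (ltW uA).
by apply: ereal_sup_ubound; exists t.
Qed.

Lemma limsup_norm_le_far (u : R -> V) (r e : R) : 0 < e ->
  (limsup_norm u <= r%:E)%E ->
  exists T : R, forall t, T <= `|t| -> rnorm (u t) <= r + e.
Proof.
move=> e0; rewrite /limsup_norm ge_max => /andP[up un].
have [M [Mreal uM]] := limf_esup_le_near _ e0 up.
have [N [Nreal uN]] := limf_esup_le_near _ e0 un.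
exists (`|M| + `|N| + 1) => t; have := ler_norm M; have := ler_norm (- N).
have := normr_ge0 M; have := normr_ge0 N; rewrite normrN.
have [t0|t0] := ltP t 0; [rewrite (ltr0_norm t0)|rewrite (ger0_norm t0)] => *.
  by apply: uN; lra.
by apply: uM; lra.
Qed.

End LimsupNorm.

(** * The difference condition *)

Unset Implicit Arguments.

Theorem theorem6p5 (R : realType) (k : scalar_kind)
    (X : completeNormedModType (scalars R k))
    (X_nontrivial : exists x : X, x != 0)
    (gamma : R -> (scalars R k)^o)
    (gamma_BC : BC (scalars R k)^o [set: R] gamma)
    (gamma_inf : 0 < inf (range (fun t : R => rnorm (gamma t))))
    (gamma_invariant :
       invariant_set (scale_set gamma (BUC X [set: R])))
    (gamma_mean :
       scale_set gamma (BUC X [set: R]) `<=`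
       mean_class [set: R] (scale_set gamma (BUC X [set: R])))
    (gamma_limsup : forall u v : R -> X, BUC X [set: R] u -> BUC X [set: R] v ->
       (limsup_norm u <= sup_norm (fun t => u t + gamma t *: v t)%R)%E)
    (J : set R)
    (HJ : [\/ exists alpha : R, J = `[alpha, +oo[%classic,
              exists alpha : R, J = `]alpha, +oo[%classic | J = [set: R]]) :
  condition_Delta J
    (sum_set (BUC X J) (scale_set gamma (BUC X J))).
Proof.
set c0 := inf _ in gamma_inf.
have gamma_ge t : c0 <= rnorm (gamma t).
  apply: ge_inf; last by exists t.
  by exists 0 => _ [s _ <-]; exact: rnorm_ge0.
have [C0 gamma_le] : exists C0 : R, forall t, rnorm (gamma t) <= C0.
  have /rnorm_boundedP[C0 gC] := gamma_BC.2.
  by exists C0 => t; exact: gC.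
have gamma_continuous t (e : R) : 0 < e -> exists2 d : R, 0 < d &
    forall s, `|s - t| < d -> rnorm (gamma s - gamma t) <= e.
  move=> e0; have gc := (@continuous_subspace_setT R _ gamma).2 gamma_BC.1.
  have /rnorm_cvgP/(_ _ e0)/nbhs_ballP[d /= d0 dg] := gc t.
  by exists d => // s st; apply: dg; rewrite -ball_normE/= distrC.
have gamma_integrable (v : R -> X) : buc_on setT v ->
    bounded_integrable_on setT (fun t => gamma t *: v t).
  move=> vbuc a b _ ab; have [[M vM] _] := vbuc.
  have gv : scale_set gamma (BUC X setT) (fun t => gamma t *: v t).
    by exists v => //; exact/BUCP.
  have [/(_ a b ab) gvL _] := gamma_mean _ gv.
  apply: (bounded_integral_exists (C := C0 * M)).
    by apply: bochner_integrable_ae_simple_limit; exact: gvL.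
  by move=> t _; rewrite rnormZ ler_pM ?rnorm_ge0 ?gamma_le ?vM.
have gamma_moving_mean (v : R -> X) : buc_on setT v -> forall h : R, 0 < h ->
    exists2 v' : R -> X, buc_on setT v' &
    forall t, moving_mean h (fun t => gamma t *: v t) t = gamma t *: v' t.
  move=> vbuc h h0.
  have gv : scale_set gamma (BUC X setT) (fun t => gamma t *: v t).
    by exists v => //; exact/BUCP.
  have [_ /(_ h h0) [v' /BUCP v'buc v'E]] := gamma_mean _ gv.
  by exists v' => // t; rewrite moving_meanE -v'E.
have gamma_far (u v : R -> X) : buc_on setT u -> buc_on setT v ->
    forall r : R, (forall t, rnorm (u t + gamma t *: v t) <= r) ->
    forall e : R, 0 < e -> exists T : R, forall t, T <= `|t| -> rnorm (u t) <= r + e.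
  move=> /BUCP ubuc /BUCP vbuc r uvr e e0; apply: (limsup_norm_le_far e0).
  apply: le_trans (gamma_limsup u v ubuc vbuc) _.
  by apply: ge_ereal_sup => _ [t _ <-]; rewrite lee_fin.
have Jup := half_line_up HJ.
have [eta [T0 [eta01 etaL eta_out eta_far]]] := half_line_cutoff HJ.
move=> f fL1 fd h h0.
have f_limit (a b : R) : J a -> a <= b -> ae_simple_limit a b f.
  move=> Ja ab; apply: bochner_integrable_ae_simple_limit; apply: fL1 => // t /=.
  by rewrite in_itv/= => /andP[at_ _]; exact: Jup Ja at_.
have f_difference (a : R) : 0 < a -> in_sum_on gamma J (fun t => f (t + a) - f t).
  move=> /fd[u /BUCP uJ [_ [v /BUCP vJ <-] uvE]]; exists u, v; split => // t _.
  by rewrite -[LHS]/(difference a f t) -uvE.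
have approx (e : R) : 0 < e -> exists u v : R -> X, [/\ buc_on J u, buc_on J v &
    forall t, J t -> rnorm (f t - moving_mean h f t - (u t + gamma t *: v t)) <= e].
  exact: (sub_mean_approximable gamma_inf gamma_ge gamma_le gamma_continuous
    gamma_integrable gamma_moving_mean Jup (half_line_retract HJ) f_limit f_difference h0).
have [u [v [uJ vJ uvE]]] := uniform_limit_buc_on_sum gamma_inf gamma_ge
  gamma_continuous gamma_far eta01 etaL eta_out eta_far approx.
(* Off J the values are irrelevant, and the first summand absorbs them. *)
exists (fun t => if t \in J then u t else f t - mean h f t).
  by apply/BUCP; apply: eq_buc_on uJ => t Jt; rewrite mem_set.
exists (fun t => gamma t *: (if t \in J then v t else 0)).
  exists (fun t => if t \in J then v t else 0) => //.
  by apply/BUCP; apply: eq_buc_on vJ => t Jt; rewrite mem_set.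
apply/funext => t; case: ifPn => [|_]; last by rewrite scaler0 addr0.
by rewrite inE => Jt; rewrite -uvE// moving_meanE.
Qed.
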